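(* (a) A functional $\tau=(\tau_n)_{n=0}^\infty\in\mathbb{C}^\infty$ is an analytic moment functional on $(l_{\mathrm{fin}},\star)$ if and only if the function $$B(\lambda):=\sum_{n=0}^\infty\frac{\lambda^n}{n!}\tau_n$$ is a Bogoliubov functional in some neighborhood of zero in $\mathbb{C}$. (b) Vice versa, a function $B:\mathcal{U}\to\mathbb{C}$ that is analytic in a neighborhood $\mathcal{U}$ of zero in $\mathbb{C}$ is a Bogoliubov functional in $\mathcal{U}$ if and only if the functional $\tau=(\tau_n)_{n=0}^\infty=(B^{(n)}(0))_{n=0}^\infty$, $\tau_n:=B^{(n)}(0)=\frac{d^n}{d\lambda^n}B(\lambda)\big|_{\lambda=0}$, is an analytic moment functional on $(l_{\mathrm{fin}},\star)$.
   Context: $\mathbb{C}^\infty$ is the space of all complex sequences, identified with the space of all linear functionals on its subspace $l_{\mathrm{fin}}$ of finitely supported sequences. The Newton polynomials are $(x)_0=1$, $(x)_n=x(x-1)\cdots(x-n+1)$ for $n\ge1$. The product $\star$ on $l_{\mathrm{fin}}$ is $f\star g:=I^{-1}(If\cdot Ig)$, where $I:l_{\mathrm{fin}}\to\mathbb{C}[x]$ is the linear bijection $(If)(x)=\sum_n f_n(x)_n$. A function $B:\mathcal{U}\to\mathbb{C}$, where $\mathcal{U}$ is a neighborhood of zero in $\mathbb{C}$, is a Bogoliubov functional in $\mathcal{U}$ if it admits the integral representation $$B(\lambda)=\int_{\mathbb{R}}(1+\lambda)^x\,d\mu(x)=\int_{\mathbb{R}}e^{x\log(1+\lambda)}\,d\mu(x),\quad\lambda\in\mathcal{U},$$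 with some non-negative finite Borel measure $\mu$ on $\mathbb{R}$. $\mathcal{M}_a(\mathbb{R})$ is the set of non-negative finite Borel measures $\mu$ on $\mathbb{R}$ whose Laplace transform $l_\mu(\lambda)=\int_{\mathbb{R}}e^{x\lambda}\,d\mu(x)$ is well-defined in a neighborhood of $0\in\mathbb{C}$ and holomorphic at $0$. A functional $\tau\in\mathbb{C}^\infty$ is an analytic moment functional on $(l_{\mathrm{fin}},\star)$ if there is $\mu\in\mathcal{M}_a(\mathbb{R})$ with $\tau_n=\int_{\mathbb{R}}(x)_n\,d\mu(x)$ for all $n\ge0$.
   Formalization: In (b), false for arbitrary U (e.g. B=1/(1-log(1+λ)), 10i in U), ''in U'' is proved for U open, connected, 1+U off the cut (-∞,0], with |1+λ|-1 in U for each λ in U; for any open U the equivalence is with B being Bogoliubov in some neighborhood V of 0 inside U. *)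

(* Defs.v *)
From HB Require Import structures.
From mathcomp Require Import all_boot all_order all_algebra.
From mathcomp Require Import all_classical all_reals all_analysis.
From mathcomp Require Import lra.
From mathcomp Require Export complex.

Set Implicit Arguments.
Unset Strict Implicit.
Unset Printing Implicit Defensive.
Import Order.TTheory GRing.Theory Num.Theory.
Import numFieldNormedType.Exports.

Local Open Scope classical_set_scope.
Local Open Scope ring_scope.
Local Open Scope complex_scope.

(* The topology, metric and normed module structures of a numFieldType are
   attached to its carrier only for abstract fields; they are transferred here
   to the concrete field R[i]. *)
#[non_forgetful_inheritance]
HB.instance Definition _ (R : realType) :=
  PseudoPointedMetric.copy R[i] (R[i] : numFieldType)^o.
#[non_forgetful_inheritance]
HB.instance Definition _ (R : realType) :=
  GRing.ComAlgebra.copy R[i] (R[i] : numFieldType)^o.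
#[non_forgetful_inheritance]
HB.instance Definition _ (R : realType) :=
  Vector.copy R[i] (R[i] : numFieldType)^o.
#[non_forgetful_inheritance]
HB.instance Definition _ (R : realType) :=
  NormedModule.copy R[i] (R[i] : numFieldType)^o.

Definition cexp (R : realType) (z : R[i]) : R[i] :=
  (expR (complex.Re z) * cos (complex.Im z))
  +i* (expR (complex.Re z) * sin (complex.Im z)).

Definition cmod (R : realType) (z : R[i]) : R :=
  Num.sqrt (complex.Re z ^+ 2 + complex.Im z ^+ 2).

(* Principal argument, with values in ]-pi, pi]; meaningless at 0. *)
Definition carg (R : realType) (z : R[i]) : R :=
  if 0 <= complex.Im z then acos (complex.Re z / cmod z)
  else - acos (complex.Re z / cmod z).

Definition clog (R : realType) (z : R[i]) : R[i] := ln (cmod z) +i* carg z.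

Definition slit_plane (R : realType) : set R[i] :=
  [set z | ~ (complex.Im z = 0 /\ complex.Re z <= 0)].

Definition cpow (R : realType) (z : R[i]) (x : R) : R[i] :=
  cexp (x%:C * clog z).

Definition borel_measure (R : realType) : Type :=
  {finite_measure set (measurableTypeR R) -> \bar R}.

Definition cintegrable (R : realType) (mu : borel_measure R) (f : R -> R[i]) :
    Prop :=
  mu.-integrable setT (fun x => (complex.Re (f x))%:E) /\
  mu.-integrable setT (fun x => (complex.Im (f x))%:E).

Definition cintegral (R : realType) (mu : borel_measure R) (f : R -> R[i]) :
    R[i] :=
  Rintegral mu setT (fun x => complex.Re (f x))
  +i* Rintegral mu setT (fun x => complex.Im (f x)).

Definition laplace (R : realType) (mu : borel_measure R) (l : R[i]) : R[i] :=
  cintegral mu (fun x => cexp (x%:C * l)).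

(* The class M_a(R). *)
Definition has_analytic_laplace (R : realType) (mu : borel_measure R) : Prop :=
  exists2 U : set R[i], open_nbhs 0 U &
    forall l, U l ->
      cintegrable mu (fun x => cexp (x%:C * l)) /\
      derivable (laplace mu) l 1.

Definition newton (R : realType) (n : nat) (x : R) : R :=
  \prod_(k < n) (x - k%:R).

Definition analytic_moment_functional (R : realType) (tau : nat -> R[i]) :
    Prop :=
  exists2 mu : borel_measure R, has_analytic_laplace mu &
    forall n, mu.-integrable setT (fun x => (newton n x)%:E) /\
      tau n = (Rintegral mu setT (@newton R n))%:C.

(* The representation involves log (1 + l), hence -1 is excluded from U. Only
   the restriction of B to U matters. *)
Definition bogoliubov_in (R : realType) (U : set R[i]) (B : R[i] -> R[i]) :
    Prop :=
  [/\ nbhs 0 U, (forall l, U l -> 1 + l != 0) &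
    exists mu : borel_measure R, forall l, U l ->
      cintegrable mu (cpow (1 + l)) /\ B l = cintegral mu (cpow (1 + l))].

(* Local representability by a power series at every point; meant for open U. *)
Definition analytic_on (R : realType) (U : set R[i]) (B : R[i] -> R[i]) :
    Prop :=
  forall z, U z -> exists a : nat -> R[i],
    \forall h \near (0 : R[i]),
      series (fun n => a n * h ^+ n) @ \oo --> B (z + h).

Definition gen_series (R : realType) (tau : nat -> R[i]) (l : R[i]) :
    nat -> R[i] :=
  series (fun n => l ^+ n / n`!%:R * tau n).

Definition derivatives_at0 (R : realType) (B : R[i] -> R[i]) (n : nat) :
    R[i] :=
  derive1n n B 0.

(* The integral of (1 + l) ^ x converges or diverges according to |1 + l| only,
   and log (1 + l) is holomorphic off the cut l <= -1. The domains below are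
   those on which both are controlled: 1 + U avoids the cut, and U contains the
   real point |1 + l| - 1 together with l. *)
Definition log_domain (R : realType) (U : set R[i]) : Prop :=
  [/\ open_nbhs 0 U, connected U,
      (forall l, U l -> slit_plane (1 + l)) &
      (forall l, U l -> U (`|1 + l| - 1))].

Lemma real_complex_continuous (R : realType) : continuous (fun x : R => x%:C : R[i]).
Proof.
move=> x; apply/cvgrPdist_lt => e e0.
have er : e = (complex.Re e)%:C.
  by move: e0; case: e => a b; rewrite ltcE /= => /andP[/eqP -> _].
near=> y.
have -> : (x%:C - y%:C) = (x - y)%:C :> R[i] by rewrite rmorphB.
rewrite normc_def /= expr0n addr0 sqrtr_sqr er ltcR.
near: y; apply: cvgr_dist_lt => //.
by move: e0; rewrite er ltcR.
Unshelve. all: by end_near.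
Qed.

Lemma log_domain_disc (R : realType) (r : R[i]) : 0 < r -> r <= 1 ->
  log_domain [set l : R[i] | `|l| < r].
Proof.
move=> r0 r1; split.
- split; last by rewrite /= normr0.
  suff -> : [set l : R[i] | `|l| < r] = ball 0 r by apply: ball_open.
  by apply/seteqP; split=> x; rewrite -ball_normE /= sub0r normrN.
- have -> : [set l : R[i] | `|l| < r] = \bigcup_(l in [set l : R[i] | `|l| < r])
     ((fun t : R => t%:C * l) @` `[0,1]%classic).
    apply/seteqP; split=> [l lr|l [m /= mr [t /=]]].
      exists l => //; exists 1; rewrite /= ?mul1r// in_itv /= ler01 lexx //.
    rewrite in_itv /= => /andP[t0 t1] <-.
    rewrite normrM; apply: le_lt_trans mr; rewrite ler_piMl//.
    by rewrite normc_def /= expr0n addr0 sqrtr_sqr ger0_norm// lecR.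
  apply: bigcup_connected.
    exists 0 => m _; exists 0; rewrite /= ?mul0r// in_itv /= ler01 lexx //.
  move=> m _; apply: connected_continuous_connected.
    by apply: segment_connected.
  apply: continuous_subspaceT => t.
  apply: cvgMl; exact: real_complex_continuous.
- move=> l /= lr [h1 h2].
  suff h : 1 <= `|l| by have := lt_geF (lt_le_trans lr r1); rewrite h.
  rewrite normc_def lecE /= eqxx /=.
  move: h1 h2; case: l {lr} => a b /=; rewrite add0r => -> ha.
  rewrite expr0n addr0 sqrtr_sqr ler0_norm; lra.
- move=> l /= lr; apply: le_lt_trans lr.
  rewrite -[X in _ - X](normr1 R[i]).
  apply: le_trans (ler_dist_dist _ _) _.
  by rewrite addrC addKr.
Qed.

(* Main.v *)
(* Expanding (1 + l) ^ x = sum_n binom(x, n) l ^ n under the integral sign, which is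
   legitimate for small l as soon as exp (d |x|) is integrable for some d > 0, shows
   that the Taylor coefficients at 0 of the integral of (1 + l) ^ x are the moments
   int (x)_n dmu / n!.  Together with the uniqueness of power series coefficients and
   the equivalence of local finiteness of int (1 + l) ^ x dmu with that of the Laplace
   transform, this gives everything that is local at 0.

   On a log domain U one must moreover show that (1 + l) ^ x is integrable for all l in U.
   As |(1 + l) ^ x| = |1 + l| ^ x, only the real points matter, and there this is an
   analogue of the Landau (or Pringsheim) theorem on Laplace transforms of nonnegative
   measures: the integral converges as long as B continues analytically.  The equality
   on U then follows from the identity theorem. *)

(* Functions of l are handled throughout by their power series. Nothing is differentiated under the
   integral sign, and the identity theorem enters as uniqueness of coefficients: two series with the
   same centre coincide once they agree at points accumulating there.

   An expansion about z off the cut comes from z + h = z (1 + h / z). For small h the principal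
   logarithm of the product is the sum of the logarithms, and the binomial series of (1 + h / z) ^ x
   is dominated by exp (d |x|). This factor is paid for by the integrability of exp (s x) at s = ln
   |z| - d and s = ln |z| + d, so two real exponents decide about all z of a given modulus.

   The obstacle in the Landau argument is sign. For a measure on a half-line the classical proof
   uses the moments of x ^ n, which have constant sign. Here mu lives on the whole line and the
   coefficients are moments of binom(x, n), so positivity has to be manufactured from the even
   coefficients. *)
Require Import Defs.
From HB Require Import structures.
From mathcomp Require Import all_boot all_order all_algebra.
From mathcomp Require Import all_classical all_reals all_analysis.
From mathcomp Require Import measurable_realfun lra ring.
Import Order.TTheory GRing.Theory Num.Theory.
Import numFieldNormedType.Exports.
Local Open Scope classical_set_scope.
Local Open Scope ring_scope.
Local Open Scope complex_scope.
Local Notation Re := complex.Re.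
Local Notation Im := complex.Im.
Set Implicit Arguments.
Unset Strict Implicit.
Unset Printing Implicit Defensive.

(** * Complex numbers through real and imaginary parts *)

Lemma normr_cmod (R : realType) (z : R[i]) : `|z| = (cmod z)%:C.
Proof. exact: normc_def. Qed.

Lemma cmod_normc (R : realType) (z : R[i]) : cmod z = Normc.normc z.
Proof. by case: z. Qed.

Lemma cmod_ge0 (R : realType) (z : R[i]) : 0 <= cmod z.
Proof. exact: sqrtr_ge0. Qed.

Lemma cmodM (R : realType) (x y : R[i]) : cmod (x * y) = cmod x * cmod y.
Proof. by rewrite !cmod_normc Normc.normcM. Qed.

Lemma cmodV (R : realType) (x : R[i]) : cmod x^-1 = (cmod x)^-1.
Proof. by rewrite !cmod_normc Normc.normcV. Qed.

Lemma cmod_real (R : realType) (x : R) : cmod x%:C = `|x|.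
Proof. by rewrite /cmod /= expr0n addr0 sqrtr_sqr. Qed.

Lemma cmod0 (R : realType) : cmod (0 : R[i]) = 0.
Proof. by rewrite (cmod_real 0) normr0. Qed.

Lemma cmod1 (R : realType) : cmod (1 : R[i]) = 1.
Proof. by rewrite (cmod_real 1) normr1. Qed.

Lemma cmodX (R : realType) (x : R[i]) n : cmod (x ^+ n) = cmod x ^+ n.
Proof. by elim: n => [|n IH]; rewrite ?expr0 ?cmod1// !exprS cmodM IH. Qed.

Lemma cmodN (R : realType) (x : R[i]) : cmod (- x) = cmod x.
Proof. by case: x => a b; rewrite /cmod /= !sqrrN. Qed.

Lemma cmodD (R : realType) (x y : R[i]) : cmod (x + y) <= cmod x + cmod y.
Proof. by rewrite -lecR rmorphD /= -!normr_cmod ler_normD. Qed.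

Lemma cmodB (R : realType) (x y : R[i]) : cmod (x - y) <= cmod x + cmod y.
Proof. by rewrite -(cmodN y) cmodD. Qed.

Lemma cmod_distC (R : realType) (x y : R[i]) : cmod (x - y) = cmod (y - x).
Proof. by rewrite -cmodN opprB. Qed.

Lemma cmod_eq0 (R : realType) (x : R[i]) : (cmod x == 0) = (x == 0).
Proof. by rewrite -(inj_eq (@complexI R)) -normr_cmod normr_eq0. Qed.

Lemma cmod_gt0 (R : realType) (x : R[i]) : (0 < cmod x) = (x != 0).
Proof. by rewrite lt0r cmod_eq0 cmod_ge0 andbT. Qed.

Lemma cmod_sum (R : realType) (I : Type) (r : seq I) (P : pred I) (u : I -> R[i]) :
  cmod (\sum_(i <- r | P i) u i) <= \sum_(i <- r | P i) cmod (u i).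
Proof.
elim/big_rec2: _ => [|i y x Pi h]; first by rewrite cmod0.
by rewrite (le_trans (cmodD _ _))// lerD2l.
Qed.

Lemma Re_le_cmod (R : realType) (z : R[i]) : `|Re z| <= cmod z.
Proof. by rewrite -sqrtr_sqr ler_sqrt ?lerDl ?sqr_ge0// addr_ge0 ?sqr_ge0. Qed.

Lemma Im_le_cmod (R : realType) (z : R[i]) : `|Im z| <= cmod z.
Proof. by rewrite -sqrtr_sqr ler_sqrt ?lerDr ?sqr_ge0// addr_ge0 ?sqr_ge0. Qed.

Lemma cmod_le_ReIm (R : realType) (z : R[i]) : cmod z <= `|Re z| + `|Im z|.
Proof.
have h : z = (Re z)%:C + 'i%C * (Im z)%:C by exact: complexE.
rewrite {1}h (le_trans (cmodD _ _))// cmodM !cmod_real.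
by rewrite /cmod /= expr0n /= expr1n add0r sqrtr1 mul1r.
Qed.

Lemma cmod_dist_le (R : realType) (x y : R[i]) : `|cmod x - cmod y| <= cmod (x - y).
Proof.
rewrite -lecR -normr_cmod -cmod_real -normr_cmod rmorphB /= -!normr_cmod.
exact: ler_dist_dist.
Qed.

Lemma ReD (R : realType) (x y : R[i]) : Re (x + y) = Re x + Re y.
Proof. by case: x; case: y. Qed.

Lemma ImD (R : realType) (x y : R[i]) : Im (x + y) = Im x + Im y.
Proof. by case: x; case: y. Qed.

Lemma ReB (R : realType) (x y : R[i]) : Re (x - y) = Re x - Re y.
Proof. by case: x; case: y. Qed.

Lemma ImB (R : realType) (x y : R[i]) : Im (x - y) = Im x - Im y.
Proof. by case: x; case: y. Qed.

Lemma ReM (R : realType) (x y : R[i]) : Re (x * y) = Re x * Re y - Im x * Im y.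
Proof. by case: x; case: y. Qed.

Lemma ImM (R : realType) (x y : R[i]) : Im (x * y) = Re x * Im y + Im x * Re y.
Proof. by case: x; case: y. Qed.

Lemma Re_sum (R : realType) (I : Type) (r : seq I) (P : pred I) (u : I -> R[i]) :
  Re (\sum_(i <- r | P i) u i) = \sum_(i <- r | P i) Re (u i).
Proof. by apply: big_morph => // x y; rewrite ReD. Qed.

Lemma Im_sum (R : realType) (I : Type) (r : seq I) (P : pred I) (u : I -> R[i]) :
  Im (\sum_(i <- r | P i) u i) = \sum_(i <- r | P i) Im (u i).
Proof. by apply: big_morph => // x y; rewrite ImD. Qed.

Lemma ReZ (R : realType) (a : R) (z : R[i]) : Re (a%:C * z) = a * Re z.
Proof. by rewrite ReM /= mul0r subr0. Qed.

Lemma ImZ (R : realType) (a : R) (z : R[i]) : Im (a%:C * z) = a * Im z.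
Proof. by rewrite ImM /= mul0r addr0. Qed.

(** In [R[i]] the radius of a ball is itself a complex number; being positive there forces its
    imaginary part to vanish, so real radii suffice. *)
Lemma nbhs_cmodP (R : realType) (z : R[i]) (P : set R[i]) :
  nbhs z P <-> exists2 e : R, 0 < e & forall w, cmod (w - z) < e -> P w.
Proof.
split.
  move=> /(@nbhs_ballP R[i] R[i])[e /= e0 h].
  have er : e = (Re e)%:C.
    by move: e0; case: (e) => a b; rewrite ltcE /= => /andP[/eqP -> _].
  exists (Re e); first by move: e0; rewrite {1}er ltcR.
  move=> w wz; apply: h; rewrite -ball_normE /= er normr_cmod ltcR.
  by rewrite cmod_distC.
move=> [e e0 h]; apply/(@nbhs_ballP R[i] R[i]).
exists e%:C => /=; first by rewrite ltcR.
by move=> w; rewrite -ball_normE /= normr_cmod ltcR cmod_distC; exact: h.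
Qed.

Lemma cvg_cmodP (R : realType) (T : Type) (F : set_system T) (FF : Filter F)
    (u : T -> R[i]) (l : R[i]) :
  u x @[x --> F] --> l <->
  forall e : R, 0 < e -> \forall x \near F, cmod (u x - l) < e.
Proof.
split=> [h e e0|h].
  by apply: (h [set w | cmod (w - l) < e]); apply/nbhs_cmodP; exists e.
move=> P /nbhs_cmodP[e e0 hP]; rewrite nbhs_filterE /=.
by apply: filterS (h _ e0) => x; exact: hP.
Qed.

Lemma cvg_complexP (R : realType) (T : Type) (F : set_system T) (FF : Filter F)
    (u : T -> R[i]) (l : R[i]) :
  u x @[x --> F] --> l <->
  (Re (u x) @[x --> F] --> Re l) /\ (Im (u x) @[x --> F] --> Im l).
Proof.
split.
  move=> /cvg_cmodP h; split; apply/cvgrPdist_lt => e e0;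
    apply: filterS (h _ e0) => x; apply: le_lt_trans;
    rewrite cmod_distC; rewrite -?ReB -?ImB.
    exact: Re_le_cmod.
  exact: Im_le_cmod.
move=> [/cvgrPdist_lt h1 /cvgrPdist_lt h2]; apply/cvg_cmodP => e e0.
have e2 : 0 < e / 2 by rewrite divr_gt0.
apply: filterS2 (h1 _ e2) (h2 _ e2) => x a b.
rewrite cmod_distC (le_lt_trans (cmod_le_ReIm _))// ReB ImB.
by rewrite [ltRHS](splitr e) ltrD.
Qed.

Lemma cvgcMl (R : realType) (T : Type) (F : set_system T) (FF : Filter F)
    (u : T -> R[i]) (a c : R[i]) :
  u x @[x --> F] --> a -> c * u x @[x --> F] --> c * a.
Proof. exact: cvgMl_tmp. Qed.

Lemma cmod_cvg_le (R : realType) (u : nat -> R[i]) (l c : R[i]) (K : R) (m : nat) :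
  u @ \oo --> l -> (forall n, (m <= n)%N -> cmod (u n - c) <= K) ->
  cmod (l - c) <= K.
Proof.
move=> /cvg_cmodP ul uK; apply/ler_addgt0Pl => e e0.
have [N _ hN] := ul _ e0.
have -> : l - c = (u (maxn N m) - c) - (u (maxn N m) - l).
  by rewrite opprB [in RHS]addrC addrA subrK.
rewrite (le_trans (cmodB _ _))// addrC lerD//.
  by apply/ltW/hN; rewrite /= leq_maxl.
by apply: uK; rewrite leq_maxr.
Qed.

Lemma Re_series (R : realType) (u : nat -> R[i]) n :
  Re (series u n) = series (fun k => Re (u k)) n.
Proof. by rewrite /series /= Re_sum. Qed.

Lemma Im_series (R : realType) (u : nat -> R[i]) n :
  Im (series u n) = series (fun k => Im (u k)) n.
Proof. by rewrite /series /= Im_sum. Qed.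

Lemma cvg_complex_series (R : realType) (u : nat -> R[i]) (l : R[i]) :
  series u @ \oo --> l <->
  (series (fun k => Re (u k)) @ \oo --> Re l) /\
  (series (fun k => Im (u k)) @ \oo --> Im l).
Proof.
rewrite (@cvg_complexP R nat \oo _ (series u) l).
have -> : (fun n => Re (series u n)) = series (fun k => Re (u k)).
  by apply/funext => n; rewrite Re_series.
have -> : (fun n => Im (series u n)) = series (fun k => Im (u k)).
  by apply/funext => n; rewrite Im_series.
by [].
Qed.

Lemma abs_cvg_series (R : realType) (u : nat -> R[i]) :
  cvgn (series (fun n => cmod (u n))) -> exists s : R[i], series u @ \oo --> s.
Proof.
move=> h.
have aux (f : R[i] -> R) : (forall z, `|f z| <= cmod z) ->
    cvgn (series (fun n => f (u n))).
  move=> fle; apply: normed_cvg; apply: (series_le_cvg _ _ _ h) => n //.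
    exact: normr_ge0.
    exact: cmod_ge0.
  exact: fle.
exists (limn (series (fun n => Re (u n))) +i* limn (series (fun n => Im (u n)))).
apply/cvg_complex_series; split; apply: aux.
  exact: Re_le_cmod.
exact: Im_le_cmod.
Qed.

Lemma nondecreasing_series_ge0 (R : realType) (v : nat -> R) m n :
  (forall k, 0 <= v k) -> (m <= n)%N -> series v m <= series v n.
Proof.
move=> v0 mn; rewrite -subr_ge0 sub_series_geq//.
by apply: sumr_ge0.
Qed.

Lemma series_le_limn (R : realType) (v : nat -> R) n :
  (forall k, 0 <= v k) -> cvgn (series v) -> series v n <= limn (series v).
Proof.
move=> v0 vc; apply: nondecreasing_cvgn_le => // i j.
exact: nondecreasing_series_ge0.
Qed.

Lemma cvg_series_cmod_bounded (R : realType) (u : nat -> R[i]) (s : R[i]) :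
  series u @ \oo --> s -> exists M : R, forall n, cmod (u n) <= M.
Proof.
move=> /cvg_complex_series[/cvgP/cvg_series_bounded h1 /cvgP/cvg_series_bounded h2].
have [M1 [_ /(_ (M1 + 1))]] := h1; rewrite ltrDl ltr01 => /(_ isT) k1.
have [M2 [_ /(_ (M2 + 1))]] := h2; rewrite ltrDl ltr01 => /(_ isT) k2.
exists ((M1 + 1) + (M2 + 1)) => n; rewrite (le_trans (cmod_le_ReIm _))//.
by rewrite lerD// ?k1 ?k2.
Qed.

(** Abel's lemma: the terms are at most M (q / r) ^ n, a convergent geometric series. *)
Lemma abs_power_series_inside (R : realType) (c : nat -> R) (r q M : R) :
  (forall n, `|c n| * r ^+ n <= M) -> 0 <= q -> q < r ->
  cvgn (series (fun n => `|c n| * q ^+ n)).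
Proof.
move=> cM q0 qr.
have r0 : 0 < r by exact: le_lt_trans qr.
have M0 : 0 <= M by rewrite (le_trans _ (cM 0%N))// expr0 mulr1.
apply: (@series_le_cvg _ _ (geometric M (q / r))) => [n|n|n|].
- by rewrite mulr_ge0// exprn_ge0.
- by rewrite /geometric /= mulr_ge0// exprn_ge0// divr_ge0// ltW.
- rewrite /geometric /= expr_div_n mulrA ler_pdivlMr ?exprn_gt0// mulrAC.
  by rewrite ler_wpM2r ?exprn_ge0.
- apply: is_cvg_geometric_series.
  by rewrite ger0_norm ?divr_ge0// ?ltr_pdivrMr ?mul1r// ltW.
Qed.

(** * Power series *)

(** A relation, so that it records convergence together with the value. *)
Definition has_psum (R : realType) (a : nat -> R[i]) (h s : R[i]) : Prop :=
  series (fun n => a n * h ^+ n) @ \oo --> s.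

Lemma has_psum_unique (R : realType) (a : nat -> R[i]) (h s t : R[i]) :
  has_psum a h s -> has_psum a h t -> s = t.
Proof. exact: (@cvg_unique _ (@norm_hausdorff R[i] R[i])). Qed.
Arguments has_psum_unique {R a h s t}.

Lemma has_psum0 (R : realType) (a : nat -> R[i]) : has_psum a 0 (a 0%N).
Proof.
apply/cvg_cmodP => e e0; exists 1%N => //= n n0.
rewrite /series /= big_ltn// expr0 mulr1 big1_seq; last first.
  move=> i /=; rewrite mem_index_iota => /andP[i0 _].
  by rewrite expr0n gtn_eqF//= mulr0.
by rewrite addr0 subrr cmod0.
Qed.

Arguments has_psum0 {R} a.

Lemma has_psum_abs (R : realType) (a : nat -> R[i]) (h s : R[i]) (q : R) :
  has_psum a h s -> 0 <= q -> q < cmod h ->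
  cvgn (series (fun n => cmod (a n) * q ^+ n)).
Proof.
move=> /cvg_series_cmod_bounded[M hM] q0 qh.
have -> : (fun n => cmod (a n) * q ^+ n) = (fun n => `|cmod (a n)| * q ^+ n).
  by apply/funext => n; rewrite ger0_norm ?cmod_ge0.
have := @abs_power_series_inside _ (fun n => cmod (a n)) (cmod h) q M _ q0 qh.
apply => n; by rewrite ger0_norm ?cmod_ge0// -cmodX -cmodM.
Qed.

Lemma psum_abs_disc (R : realType) (a : nat -> R[i]) (g : R[i] -> R[i]) (rho q : R) :
  (forall h, cmod h < rho -> has_psum a h (g h)) -> 0 <= q -> q < rho ->
  cvgn (series (fun n => cmod (a n) * q ^+ n)).
Proof.
move=> ag q0 qr; have m0 : 0 <= (q + rho) / 2.
  by rewrite divr_ge0// addr_ge0// (le_trans q0 (ltW qr)).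
apply: (@has_psum_abs _ _ ((q + rho) / 2)%:C (g ((q + rho) / 2)%:C)) => //.
  apply: ag; rewrite cmod_real ger0_norm//.
  by rewrite ltr_pdivrMr// mulr_natr mulr2n ltrD2r.
rewrite cmod_real ger0_norm//.
by rewrite ltr_pdivlMr// mulr_natr mulr2n ltrD2l.
Qed.

(** For k >= m and |h| <= r one has |h| ^ k <= (|h| / r) ^ m r ^ k, so the tail gains the factor
    (|h| / r) ^ m. Taking m = n + 1 isolates the coefficient n; taking m = 2 gives
    differentiability. *)
Lemma psum_tail (R : realType) (a : nat -> R[i]) (h s : R[i]) (r S : R) (m : nat) :
  0 < r -> (forall n, series (fun k => cmod (a k) * r ^+ k) n <= S) ->
  cmod h <= r -> has_psum a h s ->
  cmod (s - \sum_(0 <= k < m) a k * h ^+ k) <= (cmod h / r) ^+ m * S.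
Proof.
move=> r0 hS hr /cmod_cvg_le ah; apply: (ah _ _ m) => n mn.
rewrite /series /= -[X in cmod (X - _)]/(series _ n).
rewrite -/(series (fun k => a k * h ^+ k) m) sub_series_geq//.
rewrite (le_trans (cmod_sum _ _ _))//.
have q0 : 0 <= cmod h / r by rewrite divr_ge0 ?cmod_ge0 ?ltW.
have q1 : cmod h / r <= 1 by rewrite ler_pdivrMr// mul1r.
apply: (@le_trans _ _ (\sum_(m <= k < n) (cmod h / r) ^+ m * (cmod (a k) * r ^+ k))).
  rewrite big_seq [leRHS]big_seq; apply: ler_sum => k.
  rewrite mem_index_iota => /andP[mk _].
  rewrite cmodM cmodX mulrCA ler_wpM2l ?cmod_ge0//.
  rewrite -[in leLHS](divfK (lt0r_neq0 r0) (cmod h)) exprMn.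
  apply: ler_wpM2r; first by rewrite exprn_ge0// ltW.
  exact: ler_wiXn2l.
rewrite -mulr_sumr ler_wpM2l ?exprn_ge0//.
apply: le_trans (hS n).
rewrite -sub_series_geq// lerBlDr lerDl /series /= sumr_ge0// => i _.
by rewrite mulr_ge0 ?cmod_ge0// exprn_ge0 ?ltW.
Qed.

Lemma psum_tail_disc (R : realType) (a : nat -> R[i]) (g : R[i] -> R[i]) (rho : R) :
  0 < rho -> (forall h, cmod h < rho -> has_psum a h (g h)) ->
  exists r S : R, [/\ 0 < r, 0 <= S & forall h m, cmod h <= r ->
    cmod (g h - \sum_(0 <= k < m) a k * h ^+ k) <= (cmod h / r) ^+ m * S].
Proof.
move=> rho0 ag; have r0 : 0 < rho / 2 by rewrite divr_gt0.
have r1 : rho / 2 < rho by rewrite ltr_pdivrMr// ltr_pMr// ltr1n.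
have cs := psum_abs_disc ag (ltW r0) r1.
have k0 k : 0 <= cmod (a k) * (rho / 2) ^+ k.
  by rewrite mulr_ge0 ?cmod_ge0// exprn_ge0 ?ltW.
exists (rho / 2), (limn (series (fun n => cmod (a n) * (rho / 2) ^+ n))); split=> //.
  by apply: le_trans (series_le_limn 0 k0 cs); rewrite /series /= big_nil.
move=> h m hr; apply: psum_tail => //.
  by move=> n; exact: series_le_limn.
by apply: ag; exact: le_lt_trans r1.
Qed.

(** If the coefficients below n vanish, the tail estimate at a zero h of g reads |a n| <= |h| S / r
    ^ (n + 1), and h can be taken arbitrarily small. *)
Lemma psum_zero_coef (R : realType) (a : nat -> R[i]) (g : R[i] -> R[i]) (rho : R) :
  0 < rho -> (forall h, cmod h < rho -> has_psum a h (g h)) ->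
  (forall e : R, 0 < e -> exists h, [/\ 0 < cmod h, cmod h < e & g h = 0]) ->
  forall n, a n = 0.
Proof.
move=> rho0 ag g0.
have [r [S [r0 S0 tl]]] := psum_tail_disc rho0 ag.
elim/ltn_ind => n IH; apply/eqP; rewrite -cmod_eq0 eq_le cmod_ge0 andbT.
apply/ler_addgt0Pl => e e0; rewrite addr0.
have rn0 : 0 < r ^+ n.+1 by rewrite exprn_gt0.
(* Chosen so that |h| < d makes |h| S / r ^ (n + 1) at most e; [S + 1] avoids a division by zero. *)
pose d := Num.min r (e * r ^+ n.+1 / (S + 1)).
have S1 : 0 < S + 1 by rewrite ltr_wpDl.
have d0 : 0 < d by rewrite lt_min r0 divr_gt0// mulr_gt0.
have [h [h0 hd gh]] := g0 _ d0.
move: hd; rewrite lt_min => /andP[hr he].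
have := tl h n.+1 (ltW hr).
rewrite gh sub0r cmodN big_nat_recr//= big1_seq ?add0r; last first.
  by move=> i; rewrite mem_index_iota => /andP[_ ni]; rewrite IH// mul0r.
rewrite cmodM cmodX expr_div_n exprS mulrC -!mulrA [X in _ <= X]mulrCA ler_pM2l ?exprn_gt0//.
move=> /le_trans; apply; rewrite mulrCA ler_pdivrMl//.
move: he; rewrite ltr_pdivlMr// => /ltW; rewrite mulrDr mulr1 mulrC.
by rewrite [e * _]mulrC; apply: le_trans; rewrite lerDl ltW// mulrC.
Qed.

Lemma psum_unique (R : realType) (a b : nat -> R[i]) (f g : R[i] -> R[i]) (rho : R) :
  0 < rho -> (forall h, cmod h < rho -> has_psum a h (f h)) ->
  (forall h, cmod h < rho -> has_psum b h (g h)) ->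
  (forall e : R, 0 < e -> exists h, [/\ 0 < cmod h, cmod h < e & f h = g h]) ->
  a = b.
Proof.
move=> rho0 af bg fg; pose c n := a n - b n.
suff c0 n : c n = 0 by apply/funext => n; apply/subr0_eq/c0.
apply: (@psum_zero_coef R c (fun h => f h - g h) rho rho0).
  move=> h hr; rewrite /has_psum.
  have -> : series (fun n => c n * h ^+ n) =
    series (fun n => a n * h ^+ n) - series (fun n => b n * h ^+ n).
    rewrite -seriesN -seriesD; congr series; apply/funext => k.
    by rewrite mulrBl.
  by apply: cvgB; [exact: af|exact: bg].
move=> e e0; have [h [? ? fgh]] := fg _ e0; exists h; split=> //.
by rewrite fgh subrr.
Qed.

Lemma cvg_csum (R : realType) (u : nat -> nat -> R[i]) (l : nat -> R[i]) K :
  (forall k, (fun n => u n k) @ \oo --> l k) ->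
  (fun n => \sum_(0 <= k < K) u n k) @ \oo --> \sum_(0 <= k < K) l k.
Proof.
move=> ul; elim: K => [|K IH].
  have -> : (fun n => \sum_(0 <= k < 0) u n k) = cst 0.
    by apply/funext => n; rewrite big_nil.
  by rewrite big_nil; exact: cvg_cst.
have -> : (fun n => \sum_(0 <= k < K.+1) u n k) =
    (fun n => \sum_(0 <= k < K) u n k + u n K).
  by apply/funext => n; rewrite big_nat_recr.
rewrite (big_nat_recr _ _ _ (leq0n K)).
apply: cvgD.
  exact: IH.
exact: ul.
Qed.

(** This is the binomial formula for (|d| + t) ^ n. Indices k > n, where [n - k] is truncated,
    contribute nothing because the binomial coefficient vanishes. *)
Lemma recenter_coef_bound (R : realType) (a : nat -> R[i]) (d : R[i]) (t : R) n K :
  0 <= t ->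
  \sum_(0 <= k < K) cmod (a n * d ^+ (n - k) *+ 'C(n, k)) * t ^+ k
  <= cmod (a n) * (cmod d + t) ^+ n.
Proof.
move=> t0; have F0 k : 0 <= cmod (a n * d ^+ (n - k) *+ 'C(n, k)) * t ^+ k.
  by rewrite mulr_ge0 ?cmod_ge0 ?exprn_ge0.
apply: (@le_trans _ _
    (\sum_(0 <= k < maxn K n.+1) cmod (a n * d ^+ (n - k) *+ 'C(n, k)) * t ^+ k)).
  by apply: (nondecreasing_series_ge0 F0); rewrite leq_maxl.
rewrite (big_cat_nat (leq0n n.+1))/= ?leq_maxr// [X in _ + X]big1_seq ?addr0; last first.
  move=> i /=; rewrite mem_index_iota => /andP[ni _].
  by rewrite bin_small// mulr0n cmod0 mul0r.
rewrite big_mkord exprDn mulr_sumr; apply: ler_sum => -[k /= kn] _.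
rewrite -mulr_natr !cmodM cmodX -(rmorph_nat (real_complex R)) cmod_real.
rewrite ger0_norm ?ler0n// -[X in _ <= _ * X]mulr_natr le_eqVlt.
by apply/orP; left; apply/eqP; ring.
Qed.

(** Expand (d + h) ^ n by the binomial formula and sum over n first. Row n of the double array is
    dominated by |a n| (|d| + |h|) ^ n, which is summable as |d| + |h| < rho. The new coefficients
    are exhibited as column sums because [b 1] must later be recognised as the termwise
    derivative. *)
Lemma psum_recenter (R : realType) (a : nat -> R[i]) (g : R[i] -> R[i]) (rho : R)
    (d : R[i]) :
  (forall h, cmod h < rho -> has_psum a h (g h)) -> cmod d < rho ->
  exists b : nat -> R[i],
    (forall k, series (fun n => a n * d ^+ (n - k) *+ 'C(n, k)) @ \oo --> b k) /\
    (forall h, cmod h < rho - cmod d -> has_psum b h (g (d + h))).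
Proof.
move=> ag dr; pose x n k := a n * d ^+ (n - k) *+ 'C(n, k).
have xb n k t : 0 <= t -> cmod (x n k) * t ^+ k <= cmod (a n) * (cmod d + t) ^+ n.
  move=> t0; apply: le_trans (recenter_coef_bound a d n k.+1 t0).
  rewrite big_nat_recr//= lerDr sumr_ge0// => i _.
  by rewrite mulr_ge0 ?cmod_ge0 ?exprn_ge0.
have Mc t : 0 <= t -> t < rho - cmod d ->
    cvgn (series (fun n => cmod (a n) * (cmod d + t) ^+ n)).
  move=> t0 tr; apply: (psum_abs_disc ag); first by rewrite addr_ge0 ?cmod_ge0.
  by rewrite addrC -ltrBrDr.
have bk k : exists b : R[i], series (fun n => x n k) @ \oo --> b.
  (* Any t strictly between 0 and rho - |d| works: the bound on a whole row, divided by t ^ k,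
     bounds its entry k. *)
  apply: abs_cvg_series; pose t := (rho - cmod d) / 2.
  have t0 : 0 < t by rewrite divr_gt0// subr_gt0.
  have tr : t < rho - cmod d by rewrite ltr_pdivrMr// ltr_pMr ?ltr1n// subr_gt0.
  apply: (series_le_cvg (v_ := fun n =>
     cmod (a n) * (cmod d + t) ^+ n * (t ^+ k)^-1)) => [n|n|n|].
  - exact: cmod_ge0.
  - by rewrite !mulr_ge0 ?cmod_ge0 ?exprn_ge0 ?addr_ge0 ?cmod_ge0 ?invr_ge0 ?exprn_ge0 ?ltW.
  - by rewrite ler_pdivlMr ?exprn_gt0// xb// ltW.
  - have -> : (fun n => cmod (a n) * (cmod d + t) ^+ n / t ^+ k) =
        (t ^+ k)^-1 *: (fun n => cmod (a n) * (cmod d + t) ^+ n).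
      by apply/funext => n; rewrite mulrC.
    by apply: is_cvg_seriesZ; apply: Mc => //; exact: ltW.
have [b hb] := choice bk.
exists b; split=> // h hr.
pose M n := cmod (a n) * (cmod d + cmod h) ^+ n.
have M0 n : 0 <= M n by rewrite mulr_ge0 ?cmod_ge0 ?exprn_ge0 ?addr_ge0 ?cmod_ge0.
have /cvg_ex[/= S MS] : cvgn (series M) by apply: Mc; rewrite ?cmod_ge0.
have MleS n : series M n <= S.
  by rewrite -(cvg_lim _ MS)//; apply: series_le_limn => //; apply: cvgP MS.
have row n K : (n < K)%N -> \sum_(0 <= k < K) x n k * h ^+ k = a n * (d + h) ^+ n.
  move=> nK; rewrite (big_cat_nat (leq0n n.+1))//= [X in _ + X]big1_seq ?addr0; last first.
    move=> i /=; rewrite mem_index_iota => /andP[ni _].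
    by rewrite /x bin_small// mulr0n mul0r.
  rewrite big_mkord exprDn mulr_sumr; apply: eq_bigr => -[k /= kn] _.
  by rewrite /x mulrnAl mulrnAr mulrA.
have rowb n K : cmod (\sum_(0 <= k < K) x n k * h ^+ k) <= M n.
  apply: le_trans (cmod_sum _ _ _) _.
  apply: le_trans (recenter_coef_bound a d n K (cmod_ge0 h)).
  by apply: ler_sum => k _; rewrite cmodM cmodX.
(* The array x n k vanishes for n < k, so that the rows n < K are complete in the sum
   over k < K and only a tail of the dominating series M remains. *)
have key K : cmod (series (fun k => b k * h ^+ k) K -
    series (fun n => a n * (d + h) ^+ n) K) <= S - series M K.
  apply: (@cmod_cvg_le _ (fun N => \sum_(0 <= k < K) series (fun n => x n k) N * h ^+ k)
    _ _ _ K).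
    rewrite /series; apply: cvg_csum => k.
    by apply: cvgMr_tmp; exact: hb.
  move=> N KN.
  have -> : \sum_(0 <= k < K) series (fun n => x n k) N * h ^+ k =
      \sum_(0 <= n < N) \sum_(0 <= k < K) x n k * h ^+ k.
    rewrite exchange_big /=; apply: eq_bigr => k _.
    by rewrite /series /= mulr_suml.
  rewrite (big_cat_nat (leq0n K) KN)/= addrAC /series /=.
  rewrite (eq_big_nat _ _ (F2 := fun n => a n * (d + h) ^+ n)); last first.
    by move=> n /andP[_ nK]; exact: row.
  rewrite subrr add0r (le_trans (cmod_sum _ _ _))//.
  apply: (@le_trans _ _ (\sum_(K <= n < N) M n)); first by apply: ler_sum.
  by rewrite -sub_series_geq// lerB.
have hg := ag (d + h); have dh : cmod (d + h) < rho.
  by rewrite (le_lt_trans (cmodD _ _))// addrC -ltrBrDr.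
move/cvg_cmodP: (hg dh) => hg'.
apply/cvg_cmodP => e e0; have e2 : 0 < e / 2 by rewrite divr_gt0.
move/cvgrPdist_lt: MS => /(_ _ e2) MS.
apply: filterS2 (hg' _ e2) MS => K h1 h2.
rewrite -(subrKA (series (fun n => a n * (d + h) ^+ n) K)).
rewrite (le_lt_trans (cmodD _ _))// [ltRHS](splitr e) ltrD//.
apply: le_lt_trans (key K) _; apply: le_lt_trans h2; exact: ler_norm.
Qed.

(** A quadratic remainder is what the tail estimate provides. It also restricts to real directions
    and to components, which is how derivatives along curves are obtained below. *)
Lemma quadratic_is_derive (R : realType) (g : R[i] -> R[i]) (d b : R[i]) (delta C : R) :
  0 < delta ->
  (forall h, cmod h <= delta -> cmod (g (d + h) - g d - b * h) <= C * cmod h ^+ 2) ->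
  is_derive d (1 : R[i]) g b.
Proof.
move=> delta0 gC.
suff h : h^-1 *: (g (h *: (1 : R[i]) + d) - g d) @[h --> (0 : R[i])^'] --> b.
  by apply: DeriveDef; [apply/cvg_ex; exists b|apply: cvg_lim => //; exact: norm_hausdorff].
apply/cvg_cmodP => e e0.
have C1 : 0 < `|C| + 1 by rewrite ltr_wpDl.
apply/nbhs_cmodP; exists (Num.min delta (e / (`|C| + 1))).
  by rewrite lt_min delta0 divr_gt0.
move=> h; rewrite subr0 lt_min => /andP[h1 h2] h0.
have -> : h^-1 *: (g (h *: (1 : R[i]) + d) - g d) - b = h^-1 * (g (d + h) - g d - b * h).
  rewrite mulrBr [h^-1 * (b * h)]mulrCA mulVf// mulr1 [d + h]addrC.
  by rewrite [h *: 1]mulr1.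
have ch : 0 < cmod h by rewrite cmod_gt0.
rewrite cmodM cmodV ltr_pdivrMl//.
apply: le_lt_trans (gC h (ltW h1)) _; rewrite expr2 mulrA [ltRHS]mulrC ltr_pM2r//.
apply: (@le_lt_trans _ _ (`|C| * cmod h)); first by rewrite ler_wpM2r ?cmod_ge0 ?ler_norm.
by move: h2; rewrite ltr_pdivlMr// mulrC; apply: le_lt_trans; rewrite ler_wpM2r ?cmod_ge0// lerDl.
Qed.

Lemma psum_quadratic (R : realType) (b : nat -> R[i]) (g : R[i] -> R[i]) (d : R[i])
    (rho : R) :
  0 < rho -> (forall h, cmod h < rho -> has_psum b h (g (d + h))) ->
  exists r C : R, [/\ 0 < r, 0 <= C & forall h, cmod h <= r ->
    cmod (g (d + h) - g d - b 1%N * h) <= C * cmod h ^+ 2].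
Proof.
move=> rho0 bg; have [r [S [r0 S0 tl]]] := psum_tail_disc rho0 bg.
exists r, (r ^- 2 * S); split=> //.
  by rewrite mulr_ge0// invr_ge0 exprn_ge0// ltW.
move=> h hr.
have g0 : g d = b 0%N.
  have := bg 0; rewrite addr0 cmod0 => /(_ rho0) b0.
  exact: (has_psum_unique b0 (has_psum0 b)).
have := tl h 2%N hr.
rewrite big_nat_recr//= big_nat1 expr0 mulr1 expr1 g0 opprD addrA.
have -> : (cmod h / r) ^+ 2 * S = r ^- 2 * S * cmod h ^+ 2 => //.
by rewrite expr_div_n; ring.
Qed.

Lemma psum_is_derive (R : realType) (b : nat -> R[i]) (g : R[i] -> R[i]) (d : R[i])
    (rho : R) :
  0 < rho -> (forall h, cmod h < rho -> has_psum b h (g (d + h))) ->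
  is_derive d (1 : R[i]) g (b 1%N).
Proof.
move=> rho0 bg; have [r [C [r0 _ gC]]] := psum_quadratic rho0 bg.
exact: quadratic_is_derive r0 gC.
Qed.

Definition pseries_deriv (R : realType) (a : nat -> R[i]) : nat -> R[i] :=
  fun n => a n.+1 *+ n.+1.

Lemma psum_deriv_recenter (R : realType) (a : nat -> R[i]) (d b : R[i]) :
  series (fun n => a n * d ^+ (n - 1) *+ 'C(n, 1)) @ \oo --> b ->
  has_psum (pseries_deriv a) d b.
Proof.
rewrite -(cvg_shiftS (series _)) /has_psum.
suff -> : series (fun n => pseries_deriv a n * d ^+ n) =
    (fun n => series (fun n => a n * d ^+ (n - 1) *+ 'C(n, 1)) n.+1) by [].
apply/funext => n; rewrite /series /= big_nat_recl//= bin0n mulr0n add0r.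
by apply: eq_bigr => i _; rewrite /pseries_deriv bin1 subn1 mulrnAl.
Qed.

Lemma psum_derive1 (R : realType) (a : nat -> R[i]) (g : R[i] -> R[i]) (rho : R) :
  (forall h, cmod h < rho -> has_psum a h (g h)) ->
  forall h, cmod h < rho -> has_psum (pseries_deriv a) h (derive1 g h).
Proof.
move=> ag d dr; have [b [hb1 hb2]] := psum_recenter ag dr.
have rd : 0 < rho - cmod d by rewrite subr_gt0.
have db := psum_is_derive rd hb2.
by rewrite derive1E derive_val; exact: psum_deriv_recenter (hb1 1%N).
Qed.

Lemma psum_derive1n (R : realType) (a : nat -> R[i]) (g : R[i] -> R[i]) (rho : R) n :
  (forall h, cmod h < rho -> has_psum a h (g h)) ->
  forall h, cmod h < rho ->
    has_psum (iter n (@pseries_deriv R) a) h (derive1n n g h).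
Proof.
move=> ag; elim: n => [|n IH] h hr; first exact: ag.
exact: (psum_derive1 IH).
Qed.

Lemma pseries_deriv_iter (R : realType) (a : nat -> R[i]) n k :
  iter n (@pseries_deriv R) a k *+ k`! = a (n + k)%N *+ (n + k)`!.
Proof.
elim: n k => [|n IH] k //=.
by rewrite /pseries_deriv -mulrnA -factS IH addnS.
Qed.

Lemma derivatives_at0_psum (R : realType) (a : nat -> R[i]) (g : R[i] -> R[i]) (rho : R) n :
  0 < rho -> (forall h, cmod h < rho -> has_psum a h (g h)) ->
  derivatives_at0 g n = a n *+ n`!.
Proof.
move=> rho0 ag; rewrite /derivatives_at0.
have h0 : has_psum (iter n (@pseries_deriv R) a) 0 (derive1n n g 0).
  by apply: psum_derive1n ag _ _; rewrite cmod0.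
rewrite (has_psum_unique h0 (has_psum0 _)).
by rewrite -[LHS]mulr1n -[X in _ *+ X]fact0 pseries_deriv_iter addn0.
Qed.

(** * Curves in the complex plane *)

Lemma quadratic_is_derive_real (R : realType) (f : R -> R) (t b delta C : R) :
  0 < delta ->
  (forall s, `|s| <= delta -> `|f (t + s) - f t - b * s| <= C * s ^+ 2) ->
  is_derive t (1 : R) f b.
Proof.
move=> delta0 fC.
suff h : s^-1 *: (f (s *: (1 : R) + t) - f t) @[s --> (0 : R)^'] --> b.
  by apply: DeriveDef; [apply/cvg_ex; exists b|apply: cvg_lim].
apply/cvgrPdist_lt => e e0.
have C1 : 0 < `|C| + 1 by rewrite ltr_wpDl.
near=> s.
have s0 : s != 0 by near: s; exact: nbhs_dnbhs_neq.
have s1 : `|s| < delta by near: s; apply: dnbhs0_lt.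
have s2 : `|s| < e / (`|C| + 1) by near: s; apply: dnbhs0_lt; rewrite divr_gt0.
have -> : b - s^-1 *: (f (s *: (1 : R) + t) - f t) =
    - (s^-1 * (f (t + s) - f t - b * s)).
  rewrite [s *: 1]mulr1 [s + t]addrC mulrBr [b * s]mulrC mulrA mulVf// mul1r.
  by rewrite opprB.
have n0 : 0 < `|s| by rewrite normr_gt0.
rewrite normrN normrM normfV ltr_pdivrMl//.
apply: le_lt_trans (fC s (ltW s1)) _.
rewrite -(real_normK (num_real s)) expr2 mulrA [ltRHS]mulrC ltr_pM2r//.
apply: (@le_lt_trans _ _ (`|C| * `|s|)); first by rewrite ler_wpM2r// ler_norm.
move: s2; rewrite ltr_pdivlMr// mulrC; apply: le_lt_trans.
by rewrite ler_wpM2r// lerDl.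
Unshelve. all: by end_near. Qed.

(** Componentwise, since [cexp] and [clog] are built from real functions of the components; the real
    mean value theorem then shows that a curve with zero derivative has equal end points. *)
Definition curve_derive (R : realType) (F : R -> R[i]) (t : R) (v : R[i]) : Prop :=
  is_derive t (1 : R) (fun s => Re (F s)) (Re v) /\
  is_derive t (1 : R) (fun s => Im (F s)) (Im v).

Lemma curve_deriveM (R : realType) (F G : R -> R[i]) t u v :
  curve_derive F t u -> curve_derive G t v ->
  curve_derive (fun s => F s * G s) t (u * G t + F t * v).
Proof.
move=> [F1 F2] [G1 G2]; split.
  have -> : (fun s => Re (F s * G s)) =
     (fun s => Re (F s)) * (fun s => Re (G s)) - (fun s => Im (F s)) * (fun s => Im (G s)).
    by apply/funext => s; rewrite ReM.
  apply: is_derive_eq.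
  by rewrite ReD !ReM /GRing.scale /=; ring.
have -> : (fun s => Im (F s * G s)) =
   (fun s => Re (F s)) * (fun s => Im (G s)) + (fun s => Im (F s)) * (fun s => Re (G s)).
  by apply/funext => s; rewrite ImM.
apply: (is_derive_eq (is_deriveD (is_deriveM F1 G2) (is_deriveM F2 G1))).
rewrite ImD !ImM /GRing.scale /=.
ring.
Qed.

Lemma zero_derive_unit_itv (R : realType) (f : R -> R) :
  (forall t : R, 0 <= t -> t <= 1 -> is_derive t (1 : R) f 0) -> f 1 = f 0.
Proof.
move=> f0; have [] := @MVT_segment R f (fun=> 0) 0 1 ler01.
- by move=> x; rewrite in_itv /= => /andP[x0 x1]; apply: f0; exact: ltW.
- apply: derivable_within_continuous => x; rewrite in_itv /= => /andP[x0 x1].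
  by case: (f0 x x0 x1).
- by move=> c _ /eqP; rewrite mul0r subr_eq0 => /eqP.
Qed.

Lemma zero_curve_derive (R : realType) (F : R -> R[i]) :
  (forall t : R, 0 <= t -> t <= 1 -> curve_derive F t 0) -> F 1 = F 0.
Proof.
move=> F0.
have h1 := @zero_derive_unit_itv _ (fun s => Re (F s)) (fun t a b => (F0 t a b).1).
have h2 := @zero_derive_unit_itv _ (fun s => Im (F s)) (fun t a b => (F0 t a b).2).
by apply/eqP; rewrite eq_complex; apply/andP; split; apply/eqP.
Qed.

Lemma psum_derive1_quadratic (R : realType) (a : nat -> R[i]) (g : R[i] -> R[i])
    (rho : R) (d v : R[i]) :
  (forall h, cmod h < rho -> has_psum a h (g h)) -> cmod d < rho ->
  has_psum (pseries_deriv a) d v ->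
  exists r C : R, [/\ 0 < r, 0 <= C & forall h, cmod h <= r ->
    cmod (g (d + h) - g d - v * h) <= C * cmod h ^+ 2].
Proof.
move=> ag dr av; have [b [hb1 hb2]] := psum_recenter ag dr.
have rd : 0 < rho - cmod d by rewrite subr_gt0.
have -> : v = b 1%N; last exact: psum_quadratic rd hb2.
exact: has_psum_unique av (psum_deriv_recenter (hb1 1%N)).
Qed.

Lemma psum_curve_derive (R : realType) (a : nat -> R[i]) (g : R[i] -> R[i])
    (rho : R) (t : R) (eta v : R[i]) :
  (forall h, cmod h < rho -> has_psum a h (g h)) -> cmod (t%:C * eta) < rho ->
  has_psum (pseries_deriv a) (t%:C * eta) v ->
  curve_derive (fun s => g (s%:C * eta)) t (v * eta).
Proof.
move=> ag dr av; have [r [C [r0 C0 gC]]] := psum_derive1_quadratic ag dr av.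
(* The [+ 1] lets the bound on s cover eta = 0 as well. *)
have e1 : 0 < cmod eta + 1 by rewrite ltr_wpDl ?cmod_ge0.
have key s : `|s| <= r / (cmod eta + 1) ->
    cmod (g ((t + s)%:C * eta) - g (t%:C * eta) - s%:C * (v * eta))
      <= C * cmod eta ^+ 2 * s ^+ 2.
  move=> sr; have := gC (s%:C * eta).
  rewrite rmorphD mulrDl cmodM cmod_real exprMn real_normK ?num_real//.
  rewrite [v * (s%:C * eta)]mulrCA -mulrA [cmod eta ^+ 2 * _]mulrC; apply.
  move: sr; rewrite ler_pdivlMr//; apply: le_trans.
  by rewrite ler_wpM2l// lerDl.
have rr0 : 0 < r / (cmod eta + 1) by rewrite divr_gt0.
split.
  apply: (quadratic_is_derive_real rr0) => s /key; apply: le_trans.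
  by rewrite -ReB -[X in _ - X]mulrC -ReZ -ReB Re_le_cmod.
apply: (quadratic_is_derive_real rr0) => s /key; apply: le_trans.
by rewrite -ImB -[X in _ - X]mulrC -ImZ -ImB Im_le_cmod.
Qed.

(** * The complex exponential *)

Lemma cexpD (R : realType) (z w : R[i]) : cexp (z + w) = cexp z * cexp w.
Proof.
apply/eqP; rewrite eq_complex ReM ImM /cexp /= ReD ImD expRD cosD sinD.
by apply/andP; split; apply/eqP; ring.
Qed.

Lemma cexp0 (R : realType) : cexp (0 : R[i]) = 1.
Proof. by rewrite /cexp /= expR0 cos0 sin0 mulr0 mulr1. Qed.

Lemma cmod_cexp (R : realType) (z : R[i]) : cmod (cexp z) = expR (Re z).
Proof.
rewrite /cmod /cexp /= !exprMn -mulrDr cos2Dsin2 mulr1 sqrtr_sqr.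
by rewrite ger0_norm ?expR_ge0.
Qed.

Lemma cexp_neq0 (R : realType) (z : R[i]) : cexp z != 0.
Proof. by rewrite -cmod_gt0 cmod_cexp expR_gt0. Qed.

Lemma cexpN (R : realType) (z : R[i]) : cexp (- z) = (cexp z)^-1.
Proof.
by apply: (mulfI (cexp_neq0 z)); rewrite -cexpD subrr cexp0 mulfV ?cexp_neq0.
Qed.

Lemma curve_derive_cexp (R : realType) (L : R -> R[i]) t (v : R[i]) :
  curve_derive L t v -> curve_derive (fun s => cexp (L s)) t (v * cexp (L t)).
Proof.
move=> [L1 L2]; split.
  have -> : (fun s => Re (cexp (L s))) =
      (expR \o (fun s => Re (L s))) * (cos \o (fun s => Im (L s))) by [].
  by apply: is_derive_eq; rewrite ReM /GRing.scale /=; ring.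
have -> : (fun s => Im (cexp (L s))) =
    (expR \o (fun s => Re (L s))) * (sin \o (fun s => Im (L s))) by [].
by apply: is_derive_eq; rewrite ImM /GRing.scale /=; ring.
Qed.

(** * Binomial and exponential series *)

(** The generalised binomial coefficient binom(x, n) at a real x. *)
Definition nbin (R : realType) (x : R) (n : nat) : R := newton n x / n`!%:R.

Lemma newtonS (R : realType) n (x : R) : newton n.+1 x = newton n x * (x - n%:R).
Proof. by rewrite /newton big_ord_recr. Qed.

Lemma nbin0 (R : realType) (x : R) : nbin x 0 = 1.
Proof. by rewrite /nbin /newton big_ord0 fact0 divr1. Qed.

Lemma nbinS (R : realType) (x : R) n : nbin x n.+1 * n.+1%:R = nbin x n * (x - n%:R).
Proof.
rewrite /nbin newtonS factS natrM invfM.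
have n0 : n.+1%:R != 0 :> R by rewrite pnatr_eq0.
have f0 : n`!%:R != 0 :> R by rewrite pnatr_eq0 -lt0n fact_gt0.
by move: n.+1%:R n`!%:R n0 f0 => m f m0 f0; field; rewrite m0 f0.
Qed.

Lemma eventually_nonincreasing_bounded (R : realType) (v : nat -> R) N :
  (forall n, 0 <= v n) -> (forall n, (N <= n)%N -> v n.+1 <= v n) ->
  exists M, forall n, v n <= M.
Proof.
move=> v0 vN; exists (\sum_(0 <= k < N.+1) v k) => n.
have small k : (k <= N)%N -> v k <= \sum_(0 <= k < N.+1) v k.
  move=> kN; rewrite (big_cat_nat (leq0n k) (leqW kN))/= [X in _ + X]big_ltn ?ltnS//.
  by rewrite addrCA lerDl addr_ge0// sumr_ge0.
have [nN|Nn] := leqP n N; first exact: small.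
rewrite -(subnKC (ltnW Nn)); elim: (n - N)%N => [|m IH].
  by rewrite addn0; exact: small.
by rewrite addnS; apply: le_trans IH; apply: vN; rewrite leq_addr.
Qed.

(** Ratio test at a radius r between q and 1: consecutive terms have ratio |x - n| r / (n + 1),
    which is at most 1 once |x| <= n (1 - r). The terms are then bounded at r, hence summable at
    q. *)
Lemma cvg_series_nbin (R : realType) (x q : R) : 0 <= q -> q < 1 ->
  cvgn (series (fun n => `|nbin x n| * q ^+ n)).
Proof.
move=> q0 q1; pose r := (q + 1) / 2.
have qr : q < r by rewrite ltr_pdivlMr// mulr_natr mulr2n ltrD2l.
have r1 : r < 1 by rewrite ltr_pdivrMr// mul1r -[2]/(1 + 1) ltrD2r.
have r0 : 0 < r by exact: le_lt_trans qr.
have r10 : 0 < 1 - r by rewrite subr_gt0.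
suff [M hM] : exists M, forall n, `|nbin x n| * r ^+ n <= M.
  exact: abs_power_series_inside hM q0 qr.
apply: (@eventually_nonincreasing_bounded _ _ (Num.truncn (`|x| / (1 - r))).+1).
  by move=> n; rewrite mulr_ge0// exprn_ge0// ltW.
move=> n Nn.
have xn : `|x| <= n%:R * (1 - r).
  rewrite -ler_pdivrMr// ltW// (lt_le_trans (truncnS_gt _))//.
  by rewrite ler_nat.
have n0 : 0 < n.+1%:R :> R by rewrite ltr0n.
rewrite -(ler_pM2r n0) exprS.
have -> : `|nbin x n.+1| * (r * r ^+ n) * n.+1%:R =
    (`|nbin x n| * r ^+ n) * (`|x - n%:R| * r).
  have := congr1 Num.norm (nbinS x n); rewrite !normrM (gtr0_norm n0) => e.
  rewrite mulrAC e; ring.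
rewrite ler_wpM2l ?mulr_ge0 ?exprn_ge0 ?normr_ge0 ?(ltW r0)//.
apply: (@le_trans _ _ ((`|x| + n%:R) * r)).
  by rewrite ler_wpM2r ?(ltW r0)// (le_trans (ler_normB _ _))// normr_nat.
rewrite mulrDl -natr1.
have : `|x| * r <= `|x| by rewrite ler_piMr// ltW.
move: xn; rewrite mulrBr mulr1; lra.
Qed.

(** On the right half-plane cos (atan (b / a)) = a / |z|, and atan (b / a) has the sign of b, which
    is the case distinction in [carg]. The atan form can be differentiated across the real axis. *)
Lemma carg_atan (R : realType) (z : R[i]) : 0 < Re z ->
  carg z = atan (Im z / Re z).
Proof.
case: z => a b /= a0; rewrite /carg /=.
have cosE : a / cmod (a +i* b) = cos (atan (b / a)).
  rewrite cos_atan -[LHS]invrK invf_div; congr (_^-1).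
  rewrite /cmod /= -[a in X in _ / X]gtr0_norm// -sqrtr_sqr -sqrtrV ?sqr_ge0//.
  rewrite -sqrtrM ?addr_ge0 ?sqr_ge0//; congr Num.sqrt.
  by rewrite mulrDl expr_div_n mulfV ?expf_neq0// gt_eqF.
rewrite cosE; have h1 := atan_gtNpi2 (b / a); have h2 := atan_ltpi2 (b / a).
have p2 : pi / 2 <= pi :> R by rewrite ler_pdivrMr// ler_pMr ?pi_gt0// ler1n.
case: ifPn => [b0|]; last rewrite -ltNge => b0.
  rewrite cosK// in_itv /= (le_trans (ltW h2) p2) andbT.
  by rewrite -(@atan0 R) le_atan// divr_ge0// ltW.
rewrite cosKN ?opprK//; apply/andP; split.
  by rewrite (le_trans _ (ltW h1))// lerN2.
by rewrite -(@atan0 R) le_atan// ler_pdivrMr// mul0r ltW.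
Qed.

Lemma is_derive_affine (R : realType) (c a t : R) :
  is_derive t (1 : R) (fun s => c + s * a) a.
Proof.
apply: (@quadratic_is_derive_real _ _ _ _ 1 0 ltr01) => s _.
by rewrite mul0r normr_le0; apply/eqP; ring.
Qed.

Lemma curve_derive_linear (R : realType) (z : R[i]) (t : R) :
  curve_derive (fun s => s%:C * z) t z.
Proof.
split.
  have -> : (fun s => Re (s%:C * z)) = (fun s => 0 + s * Re z).
    by apply/funext => s; rewrite ReZ add0r.
  exact: is_derive_affine.
have -> : (fun s => Im (s%:C * z)) = (fun s => 0 + s * Im z).
  by apply/funext => s; rewrite ImZ add0r.
exact: is_derive_affine.
Qed.

Lemma curve_deriveZ (R : realType) (F : R -> R[i]) (c t : R) (v : R[i]) :
  curve_derive F t v -> curve_derive (fun s => c%:C * F s) t (c%:C * v).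
Proof.
move=> [F1 F2]; split.
  have -> : (fun s => Re (c%:C * F s)) = c *: (fun s => Re (F s)).
    by apply/funext => s; rewrite ReZ.
  by rewrite ReZ; exact: is_deriveZ.
have -> : (fun s => Im (c%:C * F s)) = c *: (fun s => Im (F s)).
  by apply/funext => s; rewrite ImZ.
by rewrite ImZ; exact: is_deriveZ.
Qed.

(* A form of clog (1 + t * eta), valid for 1 + t * Re eta > 0, that avoids the case
   distinction in carg. *)
Definition clog_ray (R : realType) (eta : R[i]) (t : R) : R[i] :=
  (ln ((1 + t * Re eta) ^+ 2 + (t * Im eta) ^+ 2) / 2)
  +i* atan ((t * Im eta) / (1 + t * Re eta)).

Lemma ray_Re_gt0 (R : realType) (eta : R[i]) (t : R) :
  cmod eta < 1 -> 0 <= t -> t <= 1 -> 0 < 1 + t * Re eta.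
Proof.
move=> e1 t0 t1; rewrite -ltrBlDl sub0r ltrNl.
apply: le_lt_trans (_ : `|t * Re eta| < 1); first by rewrite -normrN ler_norm.
rewrite normrM ger0_norm// (le_lt_trans _ e1)//.
by rewrite (le_trans _ (Re_le_cmod _))// ler_piMl.
Qed.

Lemma clog_ray1 (R : realType) (eta : R[i]) : cmod eta < 1 ->
  clog_ray eta 1 = clog (1 + eta).
Proof.
move=> e1; have := ray_Re_gt0 e1 ler01 (lexx 1).
rewrite /clog_ray /clog !mul1r => re0.
have re0' : 0 < Re (1 + eta) by rewrite ReD.
rewrite carg_atan// ReD ImD /= add0r; congr (_ +i* _).
rewrite /cmod ReD ImD /= add0r.
set A := _ + _; have A0 : 0 < A by rewrite ltr_wpDr ?sqr_ge0// exprn_gt0.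
have s0 : 0 < Num.sqrt A by rewrite sqrtr_gt0.
by rewrite -{1}(sqr_sqrtr (ltW A0)) (lnXn 2 s0) -[X in X / _]mulr_natr mulfK// pnatr_eq0.
Qed.

Lemma clog_ray0 (R : realType) (eta : R[i]) : clog_ray eta 0 = 0.
Proof.
by rewrite /clog_ray !mul0r addr0 expr1n expr0n /= addr0 ln1 mul0r atan0.
Qed.

Lemma clog_ray_derive (R : realType) (eta : R[i]) (t : R) :
  0 < 1 + t * Re eta ->
  curve_derive (clog_ray eta) t (eta / (1 + t%:C * eta)).
Proof.
case: eta => a b /= re0; set c := 1 + t * a in re0 *.
have A0 : 0 < c ^+ 2 + (t * b) ^+ 2 by rewrite ltr_wpDr ?sqr_ge0// exprn_gt0.
have An0 := lt0r_neq0 A0.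
(* Multiply by the conjugate: the common denominator is |1 + t eta| ^ 2, the argument of [ln] in
   [clog_ray]. *)
have -> : (a +i* b) / (1 + t%:C * (a +i* b)) =
    ((a * c + b * (t * b)) / (c ^+ 2 + (t * b) ^+ 2))
    +i* (b / (c ^+ 2 + (t * b) ^+ 2)).
  have n0 : 1 + t%:C * (a +i* b) != 0.
    apply: contraTneq re0 => /(congr1 (@complex.Re R)).
    by rewrite ReD ReZ /= => e; rewrite /c e ltxx.
  apply: (canLR (mulfK n0)); apply/eqP; rewrite eq_complex ReM ImM ReD ImD ReZ ImZ /=.
  rewrite -/c add0r.
  by apply/andP; split; apply/eqP; rewrite /c in An0 *; field.
have dc := is_derive_affine 1 a t.
have db : is_derive t (1 : R) (fun s => s * b) b.
  by have := is_derive_affine 0 b t; congr is_derive; apply/funext => s; rewrite add0r.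
split => /=.
  have dA : is_derive t (1 : R) (fun s => (1 + s * a) ^+ 2 + (s * b) ^+ 2)
      (2 * (a * c + b * (t * b))).
    have -> : (fun s => (1 + s * a) ^+ 2 + (s * b) ^+ 2) =
      (fun s => 1 + s * a) * (fun s => 1 + s * a) + (fun s => s * b) * (fun s => s * b).
      by apply/funext => s; rewrite !expr2.
    apply: (is_derive_eq (is_deriveD (is_deriveM dc dc) (is_deriveM db db))).
    by rewrite /GRing.scale /= /c; ring.
  have dl := @is_derive1_comp R (@ln R)
    (fun s => (1 + s * a) ^+ 2 + (s * b) ^+ 2) t _ _ (is_derive1_ln A0) dA.
  have -> : (fun s => ln ((1 + s * a) ^+ 2 + (s * b) ^+ 2) / 2) =
    2^-1 *: (@ln R \o (fun s => (1 + s * a) ^+ 2 + (s * b) ^+ 2)).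
    by apply/funext => s /=; rewrite mulrC.
  apply: (is_derive_eq (is_deriveZ _ dl)); rewrite /GRing.scale /=.
  by rewrite mulrCA mulKf ?pnatr_eq0// mulrC.
have dq : is_derive t (1 : R) (fun s => s * b / (1 + s * a))
    (t * b * (- c ^- 2 * a) + c^-1 * b).
  have dv := @is_deriveV R (fun s => 1 + s * a) t a 1 (lt0r_neq0 re0) dc.
  exact: (is_derive_eq (is_deriveM db dv)).
have da := @is_derive1_comp R (@atan R) (fun s => s * b / (1 + s * a)) t _ _
  (is_derive1_atan _) dq.
apply: (is_derive_eq da); rewrite -/c.
have c0 := lt0r_neq0 re0.
have -> : t * b * (- c ^- 2 * a) + c^-1 * b = b / c ^+ 2 * (c - t * a) by field.
have -> : c - t * a = 1 by rewrite /c addrK.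
have -> : 1 + (t * b / c) ^+ 2 = (c ^+ 2 + (t * b) ^+ 2) / c ^+ 2.
  by rewrite mulrDl mulfV ?expf_neq0// expr_div_n.
by rewrite invf_div mulr1 mulrC mulrA divfK ?expf_neq0.
Qed.

Lemma has_psumZ (R : realType) (a : nat -> R[i]) (c h s : R[i]) :
  has_psum a h s -> has_psum (fun n => c * a n) h (c * s).
Proof.
move=> ahs; rewrite /has_psum.
have -> : series (fun n => c * a n * h ^+ n) =
    (fun N => c * series (fun n => a n * h ^+ n) N).
  by apply/funext => N; rewrite /series /= mulr_sumr; apply: eq_bigr => i _; rewrite mulrA.
exact: cvgcMl.
Qed.
Arguments has_psumZ {R a} c {h s}.

Lemma has_psumD (R : realType) (a b : nat -> R[i]) (h s t : R[i]) :
  has_psum a h s -> has_psum b h t -> has_psum (fun n => a n + b n) h (s + t).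
Proof.
move=> ahs bht; rewrite /has_psum.
have -> : series (fun n => (a n + b n) * h ^+ n) =
    series (fun n => a n * h ^+ n) + series (fun n => b n * h ^+ n).
  by rewrite -seriesD; congr series; apply/funext => n; rewrite mulrDl.
by apply: cvgD; [exact: ahs|exact: bht].
Qed.
Arguments has_psumD {R a b h s t}.

Lemma has_psum_mulX (R : realType) (a : nat -> R[i]) (h s : R[i]) :
  has_psum (pseries_deriv a) h s -> has_psum (fun n => a n *+ n) h (h * s).
Proof.
move=> /(has_psumZ h) hs; rewrite /has_psum.
rewrite -(cvg_shiftS (series (fun n => a n *+ n * h ^+ n))).
have -> : (fun n => series (fun n => a n *+ n * h ^+ n) n.+1) =
    series (fun n => h * pseries_deriv a n * h ^+ n); last exact: hs.
apply/funext => N; rewrite /series /= big_nat_recl//= mulr0n mul0r add0r.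
by apply: eq_bigr => i _; rewrite /pseries_deriv exprS; ring.
Qed.

Lemma psum_exists_disc (R : realType) (a : nat -> R[i]) (rho : R) :
  (forall q, 0 <= q -> q < rho -> cvgn (series (fun n => cmod (a n) * q ^+ n))) ->
  exists g, forall h, cmod h < rho -> has_psum a h (g h).
Proof.
move=> ac.
have H h : exists s, cmod h < rho -> has_psum a h s.
  have [hr|_] := boolP (cmod h < rho); last by exists 0.
  have [|s hs] := @abs_cvg_series _ (fun n => a n * h ^+ n); last by exists s.
  have -> : (fun n => cmod (a n * h ^+ n)) = (fun n => cmod (a n) * cmod h ^+ n).
    by apply/funext => n; rewrite cmodM cmodX.
  by apply: ac; rewrite ?cmod_ge0.
by have [g hg] := choice H; exists g.
Qed.

Lemma binomial_series (R : realType) (x : R) (h : R[i]) : cmod h < 1 ->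
  has_psum (fun n => (nbin x n)%:C) h (cpow (1 + h) x).
Proof.
move=> h1; set a := fun n => _.
have [g ag] : exists g, forall h, cmod h < 1 -> has_psum a h (g h).
  apply: psum_exists_disc => q q0 q1.
  have -> : (fun n => cmod (a n) * q ^+ n) = (fun n => `|nbin x n| * q ^+ n).
    by apply/funext => n; rewrite /a cmod_real.
  exact: cvg_series_nbin.
have dag := psum_derive1 ag.
have th (t : R) : 0 <= t -> t <= 1 -> cmod (t%:C * h) < 1.
  by move=> t0 t1; rewrite cmodM cmod_real ger0_norm// (le_lt_trans _ h1)// ler_piMl ?cmod_ge0.
(* Along the ray t * h, the sum g satisfies the differential equation of
   (1 + t * h) ^ x; hence g times the inverse of that power is constant. *)
have ode w : cmod w < 1 -> (1 + w) * derive1 g w = x%:C * g w.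
  move=> w1; rewrite mulrDl mul1r.
  have e1 := has_psumD (dag _ w1) (has_psum_mulX (dag _ w1)).
  have e2 := has_psumZ x%:C (ag _ w1).
  (* The recurrence (n + 1) binom(x, n + 1) + n binom(x, n) = x binom(x, n) is the differential
     equation read on coefficients. *)
  have ee : (fun n => pseries_deriv a n + a n *+ n) = (fun n => x%:C * a n).
    apply/funext => n; rewrite /pseries_deriv /a -!rmorphMn -rmorphD -rmorphM /=.
    by congr (_%:C); rewrite -[_ *+ n.+1]mulr_natr nbinS -[_ *+ n]mulr_natr; ring.
  by rewrite ee in e1; exact: has_psum_unique e1 e2.
pose F (t : R) := g (t%:C * h); pose G t := cexp ((- x)%:C * clog_ray h t).
have FG : F 1 * G 1 = F 0 * G 0.
  apply: (@zero_curve_derive _ (fun t => F t * G t)) => t t0 t1.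
  have re0 := ray_Re_gt0 h1 t0 t1.
  have w1 := th t t0 t1.
  have dF := psum_curve_derive ag w1 (dag _ w1).
  have dL : curve_derive (fun s => (- x)%:C * clog_ray h s) t
      ((- x)%:C * (h / (1 + t%:C * h))).
    by apply: curve_deriveZ; exact: clog_ray_derive.
  have := curve_deriveM dF (curve_derive_cexp dL).
  set v := (X in curve_derive _ _ X -> _); have -> // : v = 0.
  rewrite /v -/(F t) -/(G t).
  have n0 : 1 + t%:C * h != 0.
    apply: contraTneq re0 => e; rewrite -leNgt.
    by have /(congr1 (@complex.Re R)) := e; rewrite ReD ReZ /= => ->.
  have := ode _ w1; rewrite -/(F t) => /(canRL (mulKf n0)) ->.
  by rewrite rmorphN /=; field.
have G0 : G 0 = 1 by rewrite /G clog_ray0 mulr0 cexp0.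
have F0 : F 0 = 1.
  have := ag 0; rewrite cmod0 ltr01 => /(_ isT) g0.
  by rewrite /F mul0r (has_psum_unique g0 (has_psum0 _)) /a nbin0.
have -> : cpow (1 + h) x = g h; last exact: ag.
move: FG; rewrite F0 G0 mulr1 /F mul1r /G clog_ray1// rmorphN mulNr cexpN => /divr1_eq.
by rewrite /cpow => ->.
Qed.

Arguments binomial_series {R} x {h}.

Lemma cexp_series (R : realType) (h : R[i]) :
  has_psum (fun n => ((n`!%:R)^-1)%:C) h (cexp h).
Proof.
set a := fun n => _.
have ac q : 0 <= q -> cvgn (series (fun n => cmod (a n) * q ^+ n)).
  move=> q0.
  have -> : (fun n => cmod (a n) * q ^+ n) = exp_coeff q.
    apply/funext => n; rewrite /a cmod_real ger0_norm ?invr_ge0//.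
    by rewrite /exp_coeff /= mulrC.
  exact: is_cvg_series_exp_coeff.
(* The radius |h| + 1 keeps the whole closed segment from 0 to h inside the disc. *)
have [g ag] : exists g, forall w, cmod w < cmod h + 1 -> has_psum a w (g w).
  by apply: psum_exists_disc => q q0 _; exact: ac.
(* The series is its own derivative, so the sum g at t h times exp (- t h) is constant in t. *)
have da : pseries_deriv a = a.
  apply/funext => n; rewrite /pseries_deriv /a -rmorphMn /=; congr (_%:C).
  by rewrite -[LHS]mulr_natr factS natrM invfM mulrAC mulVf ?mul1r// pnatr_eq0.
pose F (t : R) := g (t%:C * h); pose G (t : R) := cexp (t%:C * - h).
have FG : F 1 * G 1 = F 0 * G 0.
  apply: (@zero_curve_derive _ (fun t => F t * G t)) => t t0 t1.
  have w1 : cmod (t%:C * h) < cmod h + 1.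
    by rewrite cmodM cmod_real ger0_norm// ltr_pwDr// ler_piMl ?cmod_ge0.
  have dF := psum_curve_derive ag w1 (_ : has_psum (pseries_deriv a) _ _).
  rewrite da in dF; have {}dF := dF _ (ag _ w1).
  have dL : curve_derive (fun s => s%:C * - h) t (- h) by exact: curve_derive_linear.
  have := curve_deriveM dF (curve_derive_cexp dL).
  set v := (X in curve_derive _ _ X -> _); have -> // : v = 0.
  by rewrite /v -/(F t) -/(G t); ring.
have -> : cexp h = g h; last by apply: ag; rewrite ltrDl.
move: FG; rewrite /F /G !mul0r mul1r mul1r cexp0 mulr1 cexpN.
have g0 : g 0 = 1.
  have := ag 0; rewrite cmod0 ltr_wpDl ?cmod_ge0// => /(_ isT) g0.
  by rewrite (has_psum_unique g0 (has_psum0 _)) /a fact0 invr1.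
by rewrite g0 => /divr1_eq.
Qed.
Arguments cexp_series {R} h.

(** * The principal logarithm *)

Lemma cos_sin_acos_cmod (R : realType) (z : R[i]) : z != 0 ->
  cos (carg z) = Re z / cmod z /\ sin (carg z) = Im z / cmod z.
Proof.
rewrite -cmod_gt0 => z0.
have x1 : -1 <= Re z / cmod z <= 1.
  rewrite -ler_norml normrM normfV (gtr0_norm z0) ler_pdivrMr// mul1r.
  exact: Re_le_cmod.
have c1 : cos (acos (Re z / cmod z)) = Re z / cmod z by apply: acosK; rewrite in_itv.
have s1 : sin (acos (Re z / cmod z)) = `|Im z| / cmod z.
  rewrite sin_acos// -[in RHS](gtr0_norm z0) -normfV -normrM -sqrtr_sqr.
  congr Num.sqrt; rewrite !expr_div_n.
  have -> : cmod z ^+ 2 = Re z ^+ 2 + Im z ^+ 2.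
    by rewrite sqr_sqrtr// addr_ge0 ?sqr_ge0.
  have n0 : Re z ^+ 2 + Im z ^+ 2 != 0.
    by rewrite gt_eqF// -sqrtr_gt0.
  by apply: (mulIf n0); rewrite mulrBl !divfK// mul1r addrAC subrr add0r.
rewrite /carg; case: ifPn => [b0|].
  by rewrite c1 s1 ger0_norm.
rewrite -ltNge => b0.
by rewrite cosN sinN c1 s1 ltr0_norm// mulNr opprK.
Qed.

Lemma clogK (R : realType) (z : R[i]) : z != 0 -> cexp (clog z) = z.
Proof.
move=> z0; have [c s] := cos_sin_acos_cmod z0.
have p : 0 < cmod z by rewrite cmod_gt0.
rewrite /cexp /clog /= c s lnK ?posrE//.
by rewrite ![cmod z * _]mulrC !divfK ?gt_eqF//; case: (z).
Qed.

Lemma cexpK (R : realType) (w : R[i]) : - pi < Im w -> Im w < pi ->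
  clog (cexp w) = w.
Proof.
move=> h1 h2; rewrite /clog cmod_cexp expRK.
suff -> : carg (cexp w) = Im w by case: (w).
rewrite /carg cmod_cexp /= [_ * cos _]mulrC mulfK ?gt_eqF ?expR_gt0//.
have [b0|b0] := leP 0 (Im w).
  rewrite mulr_ge0 ?expR_ge0 ?sin_ge0_pi ?b0 ?ltW//.
  by rewrite cosK// in_itv /= b0 ltW.
rewrite leNgt.
have -> : expR (Re w) * sin (Im w) < 0.
  rewrite pmulr_rlt0 ?expR_gt0// -[sin _]opprK -sinN oppr_lt0.
  by apply: sin_gt0_pi; rewrite oppr_gt0 b0 ltrNl.
by rewrite /= cosKN ?opprK// !ltW.
Qed.

Lemma slit_plane_neq0 (R : realType) (z : R[i]) : slit_plane z -> z != 0.
Proof. by move=> h; apply/eqP => z0; apply: h; rewrite z0. Qed.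

(** The modulus pi is reached only where [acos] is evaluated at -1; off the real axis |Re z| < |z|
    strictly, and on it the slit plane leaves only the positive half-line. *)
Lemma carg_slit (R : realType) (z : R[i]) : slit_plane z -> `|carg z| < pi.
Proof.
move=> hz; have z0 := slit_plane_neq0 hz.
have p : 0 < cmod z by rewrite cmod_gt0.
have [i0|i0] := eqVneq (Im z) 0.
  have r0 : 0 < Re z by rewrite ltNge; apply/negP => r0; exact: hz.
  have c : cmod z = Re z.
    by rewrite /cmod i0 expr0n addr0 sqrtr_sqr gtr0_norm.
  by rewrite /carg i0 lexx c divff ?gt_eqF// acos1 normr0 pi_gt0.
have x1 : -1 < Re z / cmod z < 1.
  rewrite -ltr_norml normrM normfV (gtr0_norm p) ltr_pdivrMr// mul1r.
  rewrite -sqrtr_sqr ltr_sqrt ?ltrDl ?exprn_even_gt0//.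
  by rewrite ltr_wpDl ?sqr_ge0// exprn_even_gt0.
have /andP[x2 x3] := x1.
have a0 : 0 <= acos (Re z / cmod z) by rewrite acos_ge0// !ltW.
have ap : acos (Re z / cmod z) < pi by rewrite acos_ltpi// x2 ltW.
by rewrite /carg; case: ifP; rewrite ?normrN ger0_norm.
Qed.

Lemma carg_near1 (R : realType) (e : R) : 0 < e ->
  exists d : R, [/\ 0 < d, d <= 2^-1 & forall eta, cmod eta < d -> `|carg (1 + eta)| < e].
Proof.
move=> e0; have /cvgrPdist_lt/(_ _ e0) := @continuous_atan R 0.
rewrite atan0 => /nbhs_ballP[d /= d0 hd].
(* For |eta| < 1/2 the real part of 1 + eta exceeds 1/2, so the argument of atan is less than 2
   |eta| < d in modulus. *)
exists (Num.min 2^-1 (d / 2)); split.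
- by rewrite lt_min invr_gt0 ltr0n divr_gt0.
- by rewrite ge_min lexx.
move=> eta; rewrite lt_min => /andP[h1 h2].
have re : 2^-1 < Re (1 + eta).
  rewrite ReD /=; have := Re_le_cmod eta; rewrite ler_norml => /andP[h _].
  by move: h h1; rewrite [X in X < _ -> _]/cmod -/(cmod eta); lra.
have re0 : 0 < Re (1 + eta) by rewrite (lt_trans _ re)// invr_gt0.
rewrite carg_atan//; have := hd (Im (1 + eta) / Re (1 + eta)).
rewrite sub0r normrN; apply.
rewrite -ball_normE /= sub0r normrN normrM normfV (gtr0_norm re0) ltr_pdivrMr//.
rewrite ImD /= add0r (le_lt_trans (Im_le_cmod _))//; apply: lt_le_trans h2 _.
by rewrite ler_wpM2l// ltW.
Qed.

(** Off the cut |arg z| stays below pi by a positive amount; as long as |arg (1 + eta)| is below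
    that amount the sum of the arguments does not cross the cut. *)
Lemma clogM_near (R : realType) (z : R[i]) : slit_plane z ->
  exists d : R, [/\ 0 < d, d <= 2^-1 &
    forall eta, cmod eta < d -> clog (z * (1 + eta)) = clog z + clog (1 + eta)].
Proof.
move=> hz; have z0 := slit_plane_neq0 hz.
have e0 : 0 < pi - `|carg z| by rewrite subr_gt0 carg_slit.
have [d [d0 d1 hd]] := carg_near1 e0; exists d; split=> // eta he.
have n0 : 1 + eta != 0.
  apply: contraTneq he => /eqP; rewrite addrC addr_eq0 => /eqP ->.
  by rewrite cmodN cmod1 -leNgt (le_trans d1)// invf_le1// ler1n.
rewrite -{1}(clogK z0) -{1}(clogK n0) -cexpD.
have := hd _ he; rewrite ltrBrDl => h.
have : `|carg z + carg (1 + eta)| < pi by exact: le_lt_trans (ler_normD _ _) h.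
by rewrite ltr_norml => /andP[h1 h2]; apply: cexpK; rewrite ImD.
Qed.

Lemma cpowM_near (R : realType) (z : R[i]) : slit_plane z ->
  exists d : R, [/\ 0 < d, d <= 2^-1 &
    forall eta x, cmod eta < d -> cpow (z * (1 + eta)) x = cpow z x * cpow (1 + eta) x].
Proof.
move=> hz; have [d [d0 d1 hd]] := clogM_near hz; exists d; split=> // eta x he.
by rewrite /cpow hd// mulrDr cexpD.
Qed.

Lemma cmod_cpow (R : realType) (z : R[i]) x : cmod (cpow z x) = expR (x * ln (cmod z)).
Proof. by rewrite /cpow cmod_cexp ReZ. Qed.

Lemma slit_plane_pos (R : realType) (r : R) : 0 < r -> slit_plane r%:C.
Proof. by move=> r0 [_ /=]; rewrite leNgt r0. Qed.

Lemma cpow_pos (R : realType) (r x : R) : 0 < r -> cpow r%:C x = (expR (x * ln r))%:C.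
Proof.
move=> r0; rewrite /cpow /clog /carg /= lexx cmod_real gtr0_norm//.
rewrite divff ?gt_eqF// acos1 /cexp ReZ ImZ /= mulr0 cos0 sin0 mulr0 mulr1.
by [].
Qed.

(** * Integrals of complex functions depending on a parameter *)

Definition cmeasurable (R : realType) (f : R -> R[i]) : Prop :=
  measurable_fun setT (fun x : measurableTypeR R => Re (f x) : measurableTypeR R) /\
  measurable_fun setT (fun x : measurableTypeR R => Im (f x) : measurableTypeR R).

Lemma cmeasurableM (R : realType) (f g : R -> R[i]) :
  cmeasurable f -> cmeasurable g -> cmeasurable (fun x => f x * g x).
Proof.
move=> [f1 f2] [g1 g2]; split.
  under eq_fun do rewrite ReM.
  by apply: measurable_funB; apply: measurable_funM.
under eq_fun do rewrite ImM.
by apply: measurable_funD; apply: measurable_funM.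
Qed.

Lemma cmeasurable_real (R : realType) (f : R -> R) :
  measurable_fun setT (f : measurableTypeR R -> measurableTypeR R) ->
  cmeasurable (fun x => (f x)%:C).
Proof. by move=> mf; split => //=; exact: measurable_cst. Qed.

Lemma cmeasurable_cexp (R : realType) (c : R[i]) :
  cmeasurable (fun x => cexp (x%:C * c)).
Proof.
have mexp : measurable_fun setT (fun x : measurableTypeR R => expR (x * Re c) : measurableTypeR R).
  by apply: measurableT_comp => //; exact: measurable_funM.
have mlin : measurable_fun setT (fun x : measurableTypeR R => x * Im c : measurableTypeR R).
  exact: measurable_funM.
split; rewrite /cexp /=.
  under eq_fun do rewrite ReZ ImZ.
  apply: measurable_funM => //.
  apply: (measurableT_comp _ mlin); apply: continuous_measurable_fun.
  exact: continuous_cos.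
under eq_fun do rewrite ReZ ImZ.
apply: measurable_funM => //.
apply: (measurableT_comp _ mlin); apply: continuous_measurable_fun.
exact: continuous_sin.
Qed.

Lemma cmeasurable_cpow (R : realType) (z : R[i]) : cmeasurable (cpow z).
Proof. exact: cmeasurable_cexp. Qed.

Lemma measurable_newton (R : realType) n :
  measurable_fun setT (@newton R n : measurableTypeR R -> measurableTypeR R).
Proof.
elim: n => [|n IH].
  have -> : @newton R 0 = cst 1 by apply/funext => x; rewrite /newton big_ord0.
  exact: measurable_cst.
have -> : @newton R n.+1 = (fun x => newton n x * (x - n%:R)).
  by apply/funext => x; rewrite newtonS.
by apply: measurable_funM => //; apply: measurable_funB.
Qed.

Lemma measurable_nbin (R : realType) n :
  measurable_fun setT ((fun x => nbin x n) : measurableTypeR R -> measurableTypeR R).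
Proof. by apply: measurable_funM => //; exact: measurable_newton. Qed.

Lemma integrable_dom (R : realType) (mu : borel_measure R) (f g : R -> R) :
  measurable_fun setT (f : measurableTypeR R -> measurableTypeR R) ->
  (forall x, `|f x| <= g x) ->
  mu.-integrable setT (EFin \o g) -> mu.-integrable setT (EFin \o f).
Proof.
move=> mf fg; apply: le_integrable => //; first exact/measurable_EFinP.
by move=> x _ /=; rewrite lee_fin (le_trans (fg x))// ler_norm.
Qed.

Lemma cintegrable_dom (R : realType) (mu : borel_measure R) (f : R -> R[i]) (g : R -> R) :
  cmeasurable f -> (forall x, cmod (f x) <= g x) ->
  mu.-integrable setT (EFin \o g) -> cintegrable mu f.
Proof.
move=> [f1 f2] fg ig; split.
  by apply: (integrable_dom (g := g)) => // x; exact: le_trans (Re_le_cmod _) _.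
by apply: (integrable_dom (g := g)) => // x; exact: le_trans (Im_le_cmod _) _.
Qed.

Lemma cintegralMr (R : realType) (mu : borel_measure R) (f : R -> R[i]) (c : R[i]) :
  cintegrable mu f -> cintegral mu (fun x => f x * c) = cintegral mu f * c.
Proof.
move=> [f1 f2]; apply/eqP; rewrite eq_complex ReM ImM /cintegral /=.
have Z r (u : R -> R) : mu.-integrable setT (EFin \o u) ->
    mu.-integrable setT (EFin \o (fun x => u x * r)).
  by move=> iu; have := integrableZr _ r iu; apply.
apply/andP; split; apply/eqP.
  under eq_Rintegral do rewrite ReM.
  by rewrite RintegralB ?RintegralZr//; exact: Z.
under eq_Rintegral do rewrite ImM.
by rewrite RintegralD ?RintegralZr//; exact: Z.
Qed.

Lemma integrable_series (R : realType) (mu : borel_measure R) (u : nat -> R -> R) n :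
  (forall k, mu.-integrable setT (EFin \o u k)) ->
  mu.-integrable setT (EFin \o (fun x => series (fun k => u k x) n)).
Proof.
move=> iu.
have -> : EFin \o (fun x => series (fun k => u k x) n) =
    (fun x => \sum_(0 <= k < n) (u k x)%:E)%E.
  by apply/funext => x /=; rewrite /series /= -sumEFin.
by apply: integrable_sum => // i _; exact: iu.
Qed.

Lemma Rintegral_series (R : realType) (mu : borel_measure R) (u : nat -> R -> R) n :
  (forall k, mu.-integrable setT (EFin \o u k)) ->
  Rintegral mu setT (fun x => series (fun k => u k x) n) =
  series (fun k => Rintegral mu setT (u k)) n.
Proof.
move=> iu; elim: n => [|n IH].
  rewrite /series /=; under eq_Rintegral do rewrite big_nil.
  by rewrite big_nil Rintegral_cst// mul0r.
rewrite seriesSr -IH -RintegralD; first by apply: eq_Rintegral => x _; rewrite seriesSr.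
- exact: measurableT.
- exact: integrable_series.
- exact: iu.
Qed.

Lemma dominated_series (R : realType) (mu : borel_measure R) (u : nat -> R -> R)
    (f g : R -> R) :
  (forall n, measurable_fun setT (u n : measurableTypeR R -> measurableTypeR R)) ->
  (forall n x, `|u n x| <= g x) ->
  (forall n x, `|series (fun k => u k x) n| <= g x) ->
  (forall x, series (fun k => u k x) @ \oo --> f x) ->
  mu.-integrable setT (EFin \o g) ->
  mu.-integrable setT (EFin \o f) /\
  series (fun n => Rintegral mu setT (u n)) @ \oo --> Rintegral mu setT f.
Proof.
move=> mu_ ug sg sf ig.
have iu n : mu.-integrable setT (EFin \o u n) by exact: integrable_dom ig.
pose s n : R -> R := fun x => series (fun k => u k x) n.
have is_ n : mu.-integrable setT (EFin \o s n) by exact: integrable_series.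
have [] := @dominated_convergence _ _ R mu setT measurableT
  (fun n => EFin \o s n) (EFin \o f) (EFin \o g).
- by move=> n; case/integrableP: (is_ n).
- apply/measurable_EFinP; apply: (measurable_fun_cvg (h := s)) => [n|x _].
    by apply/measurable_EFinP; case/integrableP: (is_ n).
  exact: sf.
- apply: aeW => x _; apply/cvg_EFin; first by apply: nearW.
  exact: sf.
- exact: ig.
- by apply: aeW => x n _; rewrite /= lee_fin; exact: sg.
move=> if_ _ cv; split => //.
have E n : Rintegral mu setT (s n) = series (fun n => Rintegral mu setT (u n)) n.
  exact: Rintegral_series.
suff : (fun n => Rintegral mu setT (s n)) @ \oo --> Rintegral mu setT f.
  by rewrite (funext E).
apply: fine_cvg; rewrite fineK; last exact: integrable_fin_num.
exact: cv.
Qed.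

(** One majorant of the partial sums of the moduli serves for the real and imaginary parts at once,
    and for each single term. *)
Lemma cintegral_series (R : realType) (mu : borel_measure R) (u : nat -> R -> R[i])
    (f : R -> R[i]) (g : R -> R) :
  (forall n, cmeasurable (u n)) ->
  (forall n x, series (fun k => cmod (u k x)) n <= g x) ->
  (forall x, series (fun k => u k x) @ \oo --> f x) ->
  mu.-integrable setT (EFin \o g) ->
  [/\ forall n, cintegrable mu (u n), cintegrable mu f &
  series (fun n => cintegral mu (u n)) @ \oo --> cintegral mu f].
Proof.
move=> mu_ sg sf ig.
have ug n x : cmod (u n x) <= g x.
  apply: le_trans (sg n.+1 x); rewrite /series /= big_nat_recr//= lerDr.
  by apply: sumr_ge0 => i _; exact: cmod_ge0.
have sb (p : R[i] -> R) : (forall z, `|p z| <= cmod z) -> forall n x,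
    `|series (fun k => p (u k x)) n| <= g x.
  move=> pz n x; apply: le_trans (sg n x); apply: le_trans (ler_norm_sum _ _ _) _.
  by apply: ler_sum => i _; exact: pz.
have h1 := @dominated_series _ mu (fun n x => Re (u n x)) (fun x => Re (f x)) g
  (fun n => (mu_ n).1) (fun n x => le_trans (Re_le_cmod _) (ug n x))
  (sb _ (@Re_le_cmod R)) (fun x => ((cvg_complex_series _ _).1 (sf x)).1) ig.
have h2 := @dominated_series _ mu (fun n x => Im (u n x)) (fun x => Im (f x)) g
  (fun n => (mu_ n).2) (fun n x => le_trans (Im_le_cmod _) (ug n x))
  (sb _ (@Im_le_cmod R)) (fun x => ((cvg_complex_series _ _).1 (sf x)).2) ig.
split.
- by move=> n; apply: cintegrable_dom ig => //.
- by split; [exact: h1.1|exact: h2.1].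
- by apply/cvg_complex_series; split; [exact: h1.2|exact: h2.2].
Qed.

(** * Exponential integrability and expansion of the two kernels *)

(** The common currency of both transforms: s = Re l controls the Laplace kernel at l, and s = ln
    |z| controls z ^ x. *)
Definition exp_integrable (R : realType) (mu : borel_measure R) (s : R) : Prop :=
  mu.-integrable setT (EFin \o (fun x => expR (x * s))).

Lemma measurable_expRM (R : realType) (s : R) :
  measurable_fun setT ((fun x => expR (x * s)) : measurableTypeR R -> measurableTypeR R).
Proof. by apply: measurableT_comp => //; exact: measurable_funM. Qed.

Lemma expR_between (R : realType) (a b s x : R) : a <= s -> s <= b ->
  expR (x * s) <= expR (x * a) + expR (x * b).
Proof.
move=> as_ sb; have [x0|x0] := leP 0 x.
  by rewrite (le_trans (_ : _ <= expR (x * b)))// ?lerDr ?expR_ge0// ler_expR ler_wpM2l.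
by rewrite (le_trans (_ : _ <= expR (x * a)))// ?lerDl ?expR_ge0// ler_expR ler_wnM2l// ltW.
Qed.

Lemma integrable_addfun (R : realType) (mu : borel_measure R) (f g : R -> R) :
  mu.-integrable setT (EFin \o f) -> mu.-integrable setT (EFin \o g) ->
  mu.-integrable setT (EFin \o (fun x => f x + g x)).
Proof. by move=> i1 i2; have := integrableD measurableT i1 i2; apply. Qed.

Lemma exp_integrable_between (R : realType) (mu : borel_measure R) (a b s : R) :
  exp_integrable mu a -> exp_integrable mu b -> a <= s -> s <= b ->
  exp_integrable mu s.
Proof.
move=> ia ib as_ sb; apply: (integrable_dom (g := fun x => expR (x * a) + expR (x * b))).
- exact: measurable_expRM.
- by move=> x; rewrite ger0_norm ?expR_ge0// expR_between.
- exact: integrable_addfun.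
Qed.

(** Shared by the two kernels: w is the kernel at the centre and K the remaining factor, expanded
    with coefficients binom(x, n) for powers and x ^ n / n! for the Laplace kernel. *)
Lemma kernel_integral_psum (R : realType) (mu : borel_measure R) (w : R -> R[i])
    (k : nat -> R -> R) (K : R -> R[i]) (g : R -> R) (eta : R[i]) :
  cmeasurable w ->
  (forall n, measurable_fun setT (k n : measurableTypeR R -> measurableTypeR R)) ->
  (forall x, has_psum (fun n => (k n x)%:C) eta (K x)) ->
  (forall n x, cmod (w x) * series (fun m => `|k m x| * cmod eta ^+ m) n <= g x) ->
  mu.-integrable setT (EFin \o g) ->
  (forall n, cintegrable mu (fun x => w x * (k n x)%:C)) ->
  cintegrable mu (fun x => w x * K x) /\
  has_psum (fun n => cintegral mu (fun x => w x * (k n x)%:C)) eta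
    (cintegral mu (fun x => w x * K x)).
Proof.
move=> mw mk kK bd ig iw.
have [] := @cintegral_series _ mu (fun n x => w x * (k n x)%:C * eta ^+ n)
  (fun x => w x * K x) g.
- move=> n; apply: cmeasurableM.
    by apply: cmeasurableM => //; exact: cmeasurable_real.
  by split; exact: measurable_cst.
- move=> n x; apply: le_trans (bd n x); rewrite /series /= mulr_sumr le_eqVlt.
  apply/orP; left; apply/eqP; apply: eq_bigr => i _.
  by rewrite !cmodM cmodX cmod_real mulrA.
- move=> x; have -> : series (fun n => w x * (k n x)%:C * eta ^+ n) =
      (fun N => w x * series (fun n => (k n x)%:C * eta ^+ n) N).
    by apply/funext => N; rewrite /series /= mulr_sumr; apply: eq_bigr => i _; rewrite mulrA.
  by apply: cvgcMl; exact: kK.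
- exact: ig.
move=> _ i1 i2; split=> //; rewrite /has_psum.
have -> : (fun n => cintegral mu (fun x => w x * (k n x)%:C) * eta ^+ n) =
    (fun n => cintegral mu (fun x => w x * (k n x)%:C * eta ^+ n)).
  by apply/funext => n; rewrite -cintegralMr.
exact: i2.
Qed.

(** Term n is at most the partial sum of length n + 1 at q; dividing by q ^ n gives the majorant. *)
Lemma kernel_integrable (R : realType) (mu : borel_measure R) (w : R -> R[i])
    (k : nat -> R -> R) (g : R -> R) (q : R) :
  cmeasurable w -> 0 < q ->
  (forall n, measurable_fun setT (k n : measurableTypeR R -> measurableTypeR R)) ->
  (forall n x, cmod (w x) * series (fun m => `|k m x| * q ^+ m) n <= g x) ->
  mu.-integrable setT (EFin \o g) ->
  forall n, cintegrable mu (fun x => w x * (k n x)%:C).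
Proof.
move=> mw q0 mk bd ig n.
have qn : 0 < q ^+ n by rewrite exprn_gt0.
apply: (@cintegrable_dom _ _ _ (fun x => (q ^+ n)^-1 * g x)).
- by apply: cmeasurableM => //; exact: cmeasurable_real.
- move=> x; rewrite ler_pdivlMl// cmodM cmod_real; apply: le_trans (bd n.+1 x).
  rewrite mulrCA ler_wpM2l ?cmod_ge0// /series /= big_nat_recr//= mulrC lerDr.
  by apply: sumr_ge0 => i _; rewrite mulr_ge0// exprn_ge0// ltW.
- by have := integrableZl measurableT (q ^+ n)^-1 ig; apply.
Qed.

(** Each factor satisfies |x - k| <= |x| + k, and the product of the |x| + k is (-1) ^ n times the
    Newton polynomial at - |x|. Hence the absolute binomial series of exponent x at q is majorised
    by (1 - q) ^ (- |x|). *)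
Lemma nbin_abs_le (R : realType) (x : R) n : `|nbin x n| <= (-1) ^+ n * nbin (- `|x|) n.
Proof.
rewrite /nbin normrM normfV normr_nat mulrA ler_wpM2r ?invr_ge0//.
elim: n => [|n IH]; first by rewrite /newton !big_ord0 normr1 expr0 mulr1.
rewrite !newtonS normrM exprS.
have -> : -1 * (-1) ^+ n * (newton n (- `|x|) * (- `|x| - n%:R)) =
    ((-1) ^+ n * newton n (- `|x|)) * (`|x| + n%:R) by ring.
by rewrite ler_pM// (le_trans (ler_normB _ _))// normr_nat.
Qed.

Lemma binomial_series_real (R : realType) (x q : R) : `|q| < 1 ->
  series (fun n => nbin x n * q ^+ n) @ \oo --> expR (x * ln (1 + q)).
Proof.
move=> q1; have h1 : cmod q%:C < 1 by rewrite cmod_real.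
have p0 : 0 < 1 + q by move: q1; rewrite ltr_norml => /andP[]; lra.
have /cvg_complex_series[+ _] := binomial_series x h1.
have -> : 1 + q%:C = (1 + q)%:C :> R[i] by rewrite rmorphD.
rewrite cpow_pos// [X in _ --> X]/=.
have -> // : (fun k => Re ((nbin x k)%:C * q%:C ^+ k)) = (fun n => nbin x n * q ^+ n).
by apply/funext => n; rewrite ReZ -rmorphXn.
Qed.

Lemma nbin_abs_series_le (R : realType) (x q : R) n : 0 <= q -> q < 1 ->
  series (fun m => `|nbin x m| * q ^+ m) n <= expR (- `|x| * ln (1 - q)).
Proof.
move=> q0 q1; pose t m := nbin (- `|x|) m * (- q) ^+ m.
have tge m : `|nbin x m| * q ^+ m <= t m.
  rewrite /t -[- q]mulN1r exprMn mulrA ler_wpM2r ?exprn_ge0// mulrC.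
  exact: nbin_abs_le.
have ct : series t @ \oo --> expR (- `|x| * ln (1 - q)).
  by apply: binomial_series_real; rewrite normrN ger0_norm.
apply: (@le_trans _ _ (series t n)); first by apply: ler_sum.
rewrite -(cvg_lim _ ct)//; apply: series_le_limn; last exact: cvgP ct.
by move=> k; apply: le_trans (tge k); rewrite mulr_ge0// exprn_ge0.
Qed.

Lemma exp_abs_series_le (R : realType) (x q : R) n : 0 <= q ->
  series (fun m => `|x ^+ m / m`!%:R| * q ^+ m) n <= expR (`|x| * q).
Proof.
move=> q0; have xq : 0 <= `|x| * q by rewrite mulr_ge0.
have -> : (fun m => `|x ^+ m / m`!%:R| * q ^+ m) = exp_coeff (`|x| * q).
  apply/funext => m; rewrite /exp_coeff /= normrM normrX normfV normr_nat exprMn.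
  by rewrite mulrAC.
apply: series_le_limn; last exact: is_cvg_series_exp_coeff.
by move=> k; rewrite exp_coeff_ge0.
Qed.

Lemma expR_two_sided (R : realType) (s d x : R) :
  expR (x * s + `|x| * d) <= expR (x * (s - d)) + expR (x * (s + d)).
Proof.
have [x0|x0] := leP 0 x.
  by rewrite ger0_norm// -mulrDr lerDr expR_ge0.
by rewrite ltr0_norm// mulNr -mulrBr lerDl expR_ge0.
Qed.

(** Write z + h = z (1 + h / z) and integrate the binomial series of the second factor against z ^
    x, whose modulus is exp (x ln |z|). *)
Lemma cpow_expansion (R : realType) (mu : borel_measure R) (z : R[i]) (d : R) :
  slit_plane z -> 0 < d ->
  exp_integrable mu (ln (cmod z) - d) -> exp_integrable mu (ln (cmod z) + d) ->
  (forall n, cintegrable mu (fun x => cpow z x * (nbin x n)%:C)) /\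
  exists2 rho : R, 0 < rho & forall h, cmod h < rho ->
    cintegrable mu (cpow (z + h)) /\
    has_psum (fun n => cintegral mu (fun x => cpow z x * (nbin x n)%:C) * z^-1 ^+ n)
      h (cintegral mu (cpow (z + h))).
Proof.
move=> hz d0 i1 i2; have z0 := slit_plane_neq0 hz.
have cz0 : 0 < cmod z by rewrite cmod_gt0.
set s := ln (cmod z) in i1 i2.
pose g (x : R) := expR (x * (s - d)) + expR (x * (s + d)).
have ig : mu.-integrable setT (EFin \o g) by exact: integrable_addfun.
(* Solves - ln (1 - q) = d, so that the majorant (1 - q) ^ (- |x|) equals exp (d |x|) and is
   absorbed by g. *)
pose q := 1 - expR (- d).
have eN1 : expR (- d) < 1 by rewrite expR_lt1 oppr_lt0.
have q0 : 0 < q by rewrite subr_gt0.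
have q1 : q < 1 by rewrite ltrBlDr ltrDl expR_gt0.
have bd p n x : 0 <= p -> p <= q ->
    cmod (cpow z x) * series (fun m => `|nbin x m| * p ^+ m) n <= g x.
  move=> p0 pq; apply: (@le_trans _ _ (expR (x * s) * expR (`|x| * d))).
    rewrite cmod_cpow ler_wpM2l ?expR_ge0//.
    apply: le_trans (nbin_abs_series_le x n p0 (le_lt_trans pq q1)) _.
    rewrite ler_expR mulNr -mulrN ler_wpM2l// lerNl -(expRK (- d)) ler_ln ?posrE ?expR_gt0//.
      by rewrite lerBrDr -lerBrDl.
    by rewrite subr_gt0 (le_lt_trans pq).
  by rewrite -expRD; exact: expR_two_sided.
have mk n : measurable_fun setT ((fun x => nbin x n) : measurableTypeR R -> measurableTypeR R).
  exact: measurable_nbin.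
have iw := kernel_integrable (cmeasurable_cpow z) q0 mk
  (fun n x => bd q n x (ltW q0) (lexx q)) ig.
split=> //; have [e [e0 e1 he]] := cpowM_near hz.
(* Then |h / z| is below [e], where the power of the product splits, and below [q], where the series
   is dominated. *)
exists (cmod z * Num.min e q); first by rewrite mulr_gt0// lt_min e0.
move=> h hr; pose eta := h / z.
have ce : cmod eta < Num.min e q by rewrite cmodM cmodV mulrC -ltr_pdivlMl ?invr_gt0// invrK.
move: ce; rewrite lt_min => /andP[ce cq].
have zh : z + h = z * (1 + eta) by rewrite mulrDr mulr1 /eta mulrCA mulfV// mulr1.
have -> : cpow (z + h) = (fun x => cpow z x * cpow (1 + eta) x).
  by apply/funext => x; rewrite zh he.
have [i3 ps] := @kernel_integral_psum _ mu (cpow z) (fun n x => nbin x n)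
  (cpow (1 + eta)) g eta (cmeasurable_cpow z) mk
  (fun x => binomial_series x (lt_trans cq q1))
  (fun n x => bd _ n x (cmod_ge0 _) (ltW cq)) ig iw.
split=> //; move: ps; rewrite /has_psum.
set u := (X in series X @ _ --> _ -> _); set v := (X in _ -> series X @ _ --> _).
have -> // : u = v.
by apply/funext => n; rewrite /u /v /eta exprMn [h ^+ n * _]mulrC mulrA.
Qed.

(** The same argument with the exponential series, whose absolute sums are at most exp (d |x|). The
    coefficients stay anonymous because only differentiability is drawn from it. *)
Lemma laplace_expansion (R : realType) (mu : borel_measure R) (l : R[i]) (d : R) :
  0 < d -> exp_integrable mu (Re l - d) -> exp_integrable mu (Re l + d) ->
  exists a : nat -> R[i], forall h, cmod h < d ->
    cintegrable mu (fun x => cexp (x%:C * (l + h))) /\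
    has_psum a h (laplace mu (l + h)).
Proof.
move=> d0 i1 i2.
pose g (x : R) := expR (x * (Re l - d)) + expR (x * (Re l + d)).
have ig : mu.-integrable setT (EFin \o g) by exact: integrable_addfun.
pose k n (x : R) := x ^+ n / n`!%:R.
have mk n : measurable_fun setT (k n : measurableTypeR R -> measurableTypeR R).
  by apply: measurable_funM => //; exact: measurable_funX.
have bd p n x : 0 <= p -> p <= d ->
    cmod (cexp (x%:C * l)) * series (fun m => `|k m x| * p ^+ m) n <= g x.
  move=> p0 pq; apply: (@le_trans _ _ (expR (x * Re l) * expR (`|x| * d))).
    rewrite cmod_cexp ReZ ler_wpM2l ?expR_ge0//.
    by apply: le_trans (exp_abs_series_le x n p0) _; rewrite ler_expR ler_wpM2l.
  by rewrite -expRD; exact: expR_two_sided.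
have iw := kernel_integrable (cmeasurable_cexp l) d0 mk
  (fun n x => bd d n x (ltW d0) (lexx d)) ig.
exists (fun n => cintegral mu (fun x => cexp (x%:C * l) * (k n x)%:C)) => h hd.
have kK x : has_psum (fun n => (k n x)%:C) h (cexp (x%:C * h)).
  have := cexp_series (x%:C * h); rewrite /has_psum.
  set u := (X in series X @ _ --> _ -> _); set v := (X in _ -> series X @ _ --> _).
  have -> // : u = v.
  apply/funext => n; rewrite /u /v exprMn mulrA /k; congr (_ * _).
  by rewrite -rmorphXn -rmorphM /= mulrC.
have [i3 ps] := @kernel_integral_psum _ mu _ k
  (fun x => cexp (x%:C * h)) g h (cmeasurable_cexp l) mk kK
  (fun n x => bd _ n x (cmod_ge0 _) (ltW hd)) ig iw.
have E : (fun x => cexp (x%:C * (l + h))) = (fun x => cexp (x%:C * l) * cexp (x%:C * h)).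
  by apply/funext => x; rewrite mulrDr cexpD.
by rewrite /laplace E.
Qed.

Lemma open_cmod_disc (R : realType) (e : R) : open [set l : R[i] | cmod l < e].
Proof.
rewrite openE => l /= le; apply/nbhs_cmodP; exists (e - cmod l); first by rewrite subr_gt0.
move=> w wl /=; rewrite -(subrK l w) (le_lt_trans (cmodD _ _))//.
by rewrite -ltrBrDr.
Qed.

Lemma exp_integrable_analytic_laplace (R : realType) (mu : borel_measure R) (d : R) :
  0 < d -> exp_integrable mu (- d) -> exp_integrable mu d -> has_analytic_laplace mu.
Proof.
move=> d0 i1 i2; exists [set l : R[i] | cmod l < d].
  by split; [exact: open_cmod_disc|rewrite /= cmod0].
move=> l /= ld; have rl : `|Re l| < d by exact: le_lt_trans (Re_le_cmod l) ld.
have e0 : 0 < d - `|Re l| by rewrite subr_gt0.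
have [||a ha] := @laplace_expansion _ mu l _ e0.
- apply: exp_integrable_between i1 i2 _ _.
    by move: (ler_norm (- Re l)); rewrite normrN; lra.
  by move: (ler_norm (Re l)) e0; lra.
- apply: exp_integrable_between i1 i2 _ _.
    by move: (ler_norm (- Re l)) e0; rewrite normrN; lra.
  by move: (ler_norm (Re l)); lra.
split.
  by have := (ha 0 _).1; rewrite addr0 cmod0; apply.
have := psum_is_derive e0 (fun h hd => (ha h hd).2).
by case.
Qed.

Lemma analytic_laplace_exp_integrable (R : realType) (mu : borel_measure R) :
  has_analytic_laplace mu ->
  exists d : R, [/\ 0 < d, exp_integrable mu (- d) & exp_integrable mu d].
Proof.
move=> [U [oU U0] hU]; have /nbhs_cmodP[e e0 he] : nbhs (0 : R[i]) U by exact: open_nbhs_nbhs.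
have key s : `|s| < e -> exp_integrable mu s.
  move=> se; have Us : U s%:C by apply: he; rewrite subr0 cmod_real.
  have [[+ _] _] := hU _ Us; apply: eq_integrable => // x _ /=.
  by rewrite !mulr0 mul0r subr0 addr0 cos0 mulr1.
have e2 : e / 2 < e by rewrite ltr_pdivrMr// ltr_pMr// ltr1n.
have e20 : 0 < e / 2 by rewrite divr_gt0.
by exists (e / 2); split=> //; apply: key; rewrite ?normrN gtr0_norm.
Qed.

Lemma cpow_integrable_exp (R : realType) (mu : borel_measure R) (r : R) : 0 < r ->
  cintegrable mu (cpow r%:C) -> exp_integrable mu (ln r).
Proof.
move=> r0 [+ _]; apply: eq_integrable => // x _ /=.
by rewrite -[LHS]/((Re (cpow r%:C x))%:E) cpow_pos.
Qed.

Lemma cpow_near1_exp_integrable (R : realType) (mu : borel_measure R) (U : set R[i]) :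
  nbhs (0 : R[i]) U -> (forall l, U l -> cintegrable mu (cpow (1 + l))) ->
  exists d : R, [/\ 0 < d, exp_integrable mu (- d) & exp_integrable mu d].
Proof.
move=> /nbhs_cmodP[e e0 he] hU.
pose t := Num.min (e / 2) 2^-1.
have t0 : 0 < t by rewrite lt_min divr_gt0//= invr_gt0.
have te : t < e by rewrite gt_min ltr_pdivrMr// ltr_pMr// ltr1n.
have t1 : t < 1 by rewrite gt_min invf_lt1// ltr1n orbT.
have key s : `|s| <= t -> exp_integrable mu (ln (1 + s)).
  move=> st; have s1 : 0 < 1 + s by move: st; rewrite ler_norml => /andP[]; lra.
  apply: cpow_integrable_exp => //; rewrite rmorphD; apply: hU; apply: he.
  by rewrite subr0 cmod_real (le_lt_trans st).
have l1 : 0 < ln (1 + t) by rewrite ln_gt0// ltrDl.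
have l2 : ln (1 - t) < 0 by rewrite ln_lt0// subr_gt0 t1 ltrBlDr ltrDl.
have k1 : exp_integrable mu (ln (1 + t)) by apply: key; rewrite gtr0_norm.
have k2 : exp_integrable mu (ln (1 - t)) by apply: key; rewrite normrN gtr0_norm.
(* The exponents ln (1 - t) < 0 < ln (1 + t) are not symmetric about 0; the smaller distance gives a
   symmetric interval between them. *)
exists (Num.min (ln (1 + t)) (- ln (1 - t))); split.
- by rewrite lt_min l1 oppr_gt0.
- apply: exp_integrable_between k2 k1 _ _.
    by rewrite lerNr ge_min lexx orbT.
  by rewrite (le_trans _ (ltW l1))// oppr_le0 le_min ltW//= oppr_ge0 ltW.
- apply: exp_integrable_between k2 k1 _ _.
    by rewrite (le_trans (ltW l2))// le_min ltW//= oppr_ge0 ltW.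
  by rewrite ge_min lexx.
Qed.

(** * Landau's theorem *)

Lemma newtonSl (R : realType) n (x : R) : newton n.+1 x = x * newton n (x - 1).
Proof.
rewrite /newton big_ord_recl /= subr0; congr (_ * _); apply: eq_bigr => i _.
by rewrite /bump /= natrD; ring.
Qed.

(** Peel off the factor x, at most n + 1, and pass to x - 1. For x <= 1 this would leave the
    half-line, but there each factor |x - k| is at most k + 1. *)
Lemma newton_abs_le_fact (R : realType) n (x : R) :
  0 <= x -> x <= n%:R -> `|newton n x| <= n`!%:R.
Proof.
have unit01 m (y : R) : 0 <= y -> y <= 1 -> `|newton m y| <= m`!%:R.
  move=> y0 y1; elim: m => [|m IH]; first by rewrite /newton big_ord0 normr1.
  rewrite newtonS normrM factS mulnC natrM ler_pM// -natr1.
  have m0 : 0 <= m%:R :> R by [].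
  by rewrite ler_norml; apply/andP; split; lra.
elim: n x => [|n IH] x x0 xn; first by rewrite /newton big_ord0 normr1.
have [x1|x1] := leP x 1; first exact: unit01.
rewrite newtonSl normrM factS natrM ler_pM//; first by rewrite ger0_norm.
by apply: IH; [rewrite subr_ge0 ltW|rewrite lerBlDr natr1].
Qed.

(** Negative x gives an even number of negative factors and x > n gives positive factors; between 0
    and n the modulus is at most 1. *)
Lemma nbin_even_ge (R : realType) (x : R) n : ~~ odd n -> -1 <= nbin x n.
Proof.
move=> on; have f0 : 0 < n`!%:R :> R by rewrite ltr0n fact_gt0.
have [x0|x0] := leP 0 x; last first.
  have := nbin_abs_le x n; rewrite -signr_odd (negbTE on) expr0 mul1r (ltr0_norm x0) opprK.
  by move=> h; rewrite (le_trans _ h)// (le_trans _ (normr_ge0 _))// oppr_le0.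
have [xn|xn] := leP x n%:R.
  have := newton_abs_le_fact x0 xn; rewrite ler_norml => /andP[h _].
  by rewrite /nbin ler_pdivlMr// mulN1r.
rewrite (@le_trans _ _ 0)// ?oppr_le0// /nbin divr_ge0// prodr_ge0// => i _.
by rewrite subr_ge0 (le_trans _ (ltW xn))// ler_nat ltnW.
Qed.

Lemma cintegral_real (R : realType) (mu : borel_measure R) (f : R -> R) :
  cintegral mu (fun x => (f x)%:C) = (Rintegral mu setT f)%:C.
Proof. by rewrite /cintegral /= Rintegral_cst// mul0r. Qed.

(** Monotone convergence: a uniform bound on the integrals of the partial sums bounds the integral
    of the sum, with no majorant given in advance. *)
Lemma monotone_series_integrable (R : realType) (mu : borel_measure R)
    (v : nat -> R -> R) (f : R -> R) (M : R) :
  (forall n x, 0 <= v n x) ->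
  (forall n, mu.-integrable setT (EFin \o v n)) ->
  (forall x, series (fun n => v n x) @ \oo --> f x) ->
  (forall N, series (fun n => Rintegral mu setT (v n)) N <= M) ->
  mu.-integrable setT (EFin \o f).
Proof.
move=> v0 iv vf vM; pose s n : R -> R := fun x => series (fun k => v k x) n.
have s0 n x : 0 <= s n x by apply: sumr_ge0 => i _.
have is_ n : mu.-integrable setT (EFin \o s n) by exact: integrable_series.
have E n : Rintegral mu setT (s n) = series (fun n => Rintegral mu setT (v n)) n.
  exact: Rintegral_series.
have f0 x : 0 <= f x.
  rewrite -(cvg_lim _ (vf x))//; apply: limr_ge; first exact: cvgP (vf x).
  by apply: nearW => n; exact: s0.
have mf : measurable_fun setT (EFin \o f).
  apply/measurable_EFinP; apply: (measurable_fun_cvg (h := s)) => [n|x _].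
    by apply/measurable_EFinP; case/integrableP: (is_ n).
  exact: vf.
apply/integrableP; split => //.
apply: (@le_lt_trans _ _ M%:E); last exact: ltry.
have -> : (\int[mu]_x `|(EFin \o f) x|)%E =
    (\int[mu]_x limn (fun n => (EFin \o s n) x))%E.
  apply: eq_integral => x _ /=; rewrite ger0_norm//; apply/esym/cvg_lim => //.
  apply/cvg_EFin; first by apply: nearW.
  exact: vf.
rewrite monotone_convergence//.
- apply: lime_le.
    apply: ereal_nondecreasing_is_cvgn => m n mn; apply: ge0_le_integral => //.
    + by move=> x _; rewrite /= lee_fin.
    + by case/integrableP: (is_ m).
    + by case/integrableP: (is_ n).
    + move=> x _; rewrite /= lee_fin; apply: nondecreasing_series_ge0 => //.
  apply: nearW => n; rewrite -(fineK (integrable_fin_num measurableT (is_ n))) lee_fin.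
  by have := vM n; rewrite -E.
- by move=> n; case/integrableP: (is_ n).
- by move=> n x _; rewrite /= lee_fin.
- by move=> x _ m n mn; rewrite /= lee_fin; exact: nondecreasing_series_ge0.
Qed.

(* The Taylor coefficients c n of r ^ x at r only control the integrals of
   r ^ x * binom(x, n), and binom(x, n) changes sign for 0 < x < n - 1.  For even n
   however binom(x, n) >= -1 for every real x, so that the even part of the
   binomial series of (1 + q) ^ x becomes a series of nonnegative functions after adding
   a geometric series; monotone convergence then gives the integrability of
   both (1 + q) ^ x and (1 - q) ^ x against r ^ x. *)
Lemma landau_step (R : realType) (mu : borel_measure R) (r d rho t : R)
    (g : R[i] -> R[i]) :
  0 < r -> 0 < d ->
  exp_integrable mu (ln r - d) -> exp_integrable mu (ln r + d) ->
  (forall h, cmod h < rho -> has_psum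
     (fun n => cintegral mu (fun x => cpow r%:C x * (nbin x n)%:C) * (r%:C)^-1 ^+ n)
     h (g h)) ->
  0 <= t -> t < rho -> t < r ->
  exp_integrable mu (ln (r + t)) /\ exp_integrable mu (ln (r - t)).
Proof.
move=> r0 d0 i1 i2 ag t0 trho tr.
pose W (x : R) := expR (x * ln r).
have iW : exp_integrable mu (ln r) by apply: exp_integrable_between i1 i2 _ _; lra.
have [||iwb _] := @cpow_expansion _ mu r%:C d (slit_plane_pos r0) d0.
- by rewrite cmod_real gtr0_norm.
- by rewrite cmod_real gtr0_norm.
have Wb n : (fun x => cpow r%:C x * (nbin x n)%:C) = (fun x => (W x * nbin x n)%:C).
  by apply/funext => x; rewrite cpow_pos// -rmorphM.
have iWb n : mu.-integrable setT (EFin \o (fun x => W x * nbin x n)).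
  by have := iwb n; rewrite Wb => -[].
pose c n := Rintegral mu setT (fun x => W x * nbin x n).
pose I0 := Rintegral mu setT W.
pose q := t / r; have q0 : 0 <= q by rewrite divr_ge0// ltW.
have q1 : q < 1 by rewrite ltr_pdivrMr// mul1r.
(* The only use of the continuation g: its series converges absolutely at t < rho, and (t / r) ^ n =
   q ^ n. *)
have cq : cvgn (series (fun n => `|c n| * q ^+ n)).
  have := psum_abs_disc ag t0 trho.
  set u := (X in cvgn (series X) -> _); set w := (X in _ -> cvgn (series X)).
  have -> // : u = w.
  apply/funext => n; rewrite /u /w Wb cintegral_real cmodM cmod_real cmodX cmodV cmod_real.
  by rewrite (gtr0_norm r0) /q exprMn [t ^+ n * _]mulrC mulrA.
have cg : cvgn (series (geometric 1 q)).
  by apply: is_cvg_geometric_series; rewrite ger0_norm.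
(* Equal to q ^ n for even n and to 0 for odd n; the half-sum keeps the indexing uniform. *)
pose e n := (q ^+ n + (- q) ^+ n) / 2.
have e_abs n : `|e n| <= q ^+ n.
  rewrite /e normrM normfV normr_nat ler_pdivrMr// (le_trans (ler_normD _ _))//.
  by rewrite !normrX normrN ger0_norm// mulr_natr mulr2n.
(* For even n this is W q ^ n (1 + binom(x, n)) >= 0. For odd n only the geometric term remains. *)
pose v n (x : R) := W x * (q ^+ n + e n * nbin x n).
have v0 n x : 0 <= v n x.
  have qe : (- q) ^+ n = (-1) ^+ odd n * q ^+ n by rewrite [LHS]exprNn signr_odd.
  rewrite /v mulr_ge0 ?expR_ge0// /e qe.
  have qn : 0 <= q ^+ n by rewrite exprn_ge0.
  have [on|on] := boolP (odd n).
    by rewrite expr1 mulN1r subrr !mul0r addr0.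
  have := nbin_even_ge x on; rewrite expr0 mul1r.
  have -> : (q ^+ n + q ^+ n) / 2 = q ^+ n by field.
  by rewrite -[X in X + _]mulr1 -mulrDr => h; rewrite mulr_ge0// -lerBlDl sub0r.
have vE n : v n = (fun x => W x * q ^+ n + W x * nbin x n * e n).
  by apply/funext => x; rewrite /v; ring.
have iq n : mu.-integrable setT (EFin \o (fun x => W x * q ^+ n)).
  by have := integrableZr measurableT (q ^+ n) iW; apply.
have ie n : mu.-integrable setT (EFin \o (fun x => W x * nbin x n * e n)).
  by have := integrableZr measurableT (e n) (iWb n); apply.
have iv n : mu.-integrable setT (EFin \o v n).
  by rewrite vE; exact: integrable_addfun.
have I0ge : 0 <= I0 by apply: Rintegral_ge0 => x _; exact: expR_ge0.
have Iv n : Rintegral mu setT (v n) <= I0 * q ^+ n + `|c n| * q ^+ n.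
  rewrite vE RintegralD// (@RintegralZr _ _ _ mu)// (@RintegralZr _ _ _ mu)//.
  rewrite lerD2l (le_trans (ler_norm _))// normrM.
  by rewrite ler_wpM2l.
(* The sum of the v n: the geometric series plus the mean of the binomial series at q and at - q. *)
pose f (x : R) := W x * ((1 - q)^-1 +
  (expR (x * ln (1 + q)) + expR (x * ln (1 - q))) / 2).
have vf x : series (fun n => v n x) @ \oo --> f x.
  have h1 : series (geometric 1 q) @ \oo --> (1 - q)^-1.
    by have := @cvg_geometric_series R 1 q; rewrite mul1r; apply; rewrite ger0_norm.
  have h2 := @binomial_series_real R x q; rewrite ger0_norm// in h2.
  have h3 := @binomial_series_real R x (- q); rewrite normrN ger0_norm// in h3.
  have -> : series (fun n => v n x) = (fun N => W x * (series (geometric 1 q) N +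
     (series (fun n => nbin x n * q ^+ n) N + series (fun n => nbin x n * (- q) ^+ n) N) / 2)).
    apply/funext => N; elim: N => [|N IH].
      by rewrite /series /= !big_nil addr0 mul0r addr0 mulr0.
    by rewrite !seriesSr IH /v /e /geometric /=; field.
  apply: cvgMl_tmp; apply: cvgD => //; apply: cvgMr_tmp; apply: cvgD; first exact: h2.
  exact: h3.
have if_ : mu.-integrable setT (EFin \o f).
  apply: (@monotone_series_integrable _ mu v f
    (I0 * limn (series (geometric 1 q)) + limn (series (fun n => `|c n| * q ^+ n)))) => // N.
  apply: (@le_trans _ _ (I0 * series (geometric 1 q) N + series (fun n => `|c n| * q ^+ n) N)).
    rewrite /series /= mulr_sumr -big_split /=; apply: ler_sum => n _.
    by rewrite /geometric /= mul1r; exact: Iv.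
  rewrite lerD ?ler_wpM2l//; apply: series_le_limn => // k.
    by rewrite /geometric /= mul1r exprn_ge0.
  by rewrite mulr_ge0// exprn_ge0.
have i2f : mu.-integrable setT (EFin \o (fun x => f x * 2)).
  by have := integrableZr measurableT 2 if_; apply.
have rq : r * q = t by rewrite /q mulrC divfK// gt_eqF.
have W2 x s : `|s| = q -> expR (x * ln (r + r * s)) = W x * expR (x * ln (1 + s)).
  move=> sq; have s1 : 0 < 1 + s by move: q1; rewrite -sq ltr_norml => /andP[]; lra.
  by rewrite -[X in X + _]mulr1 -mulrDr lnM ?posrE// mulrDr expRD.
(* Used for s = q and s = - q; the factor 2 undoes the halving in the mean. *)
have fin s : `|s| = q -> (forall x, W x * expR (x * ln (1 + s)) <= f x * 2) ->
    exp_integrable mu (ln (r + r * s)).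
  move=> sq sf; apply: (integrable_dom (g := fun x => f x * 2)) => //.
    exact: measurable_expRM.
  by move=> x; rewrite ger0_norm ?expR_ge0// W2.
have b1 : 0 <= (1 - q)^-1 by rewrite invr_ge0 subr_ge0 ltW.
split.
  rewrite -rq; apply: fin; first by rewrite ger0_norm.
  move=> x; rewrite /f -mulrA ler_wpM2l ?expR_ge0// mulrDl divfK ?pnatr_eq0//.
  by have := expR_ge0 (x * ln (1 - q)); lra.
rewrite -rq -mulrN; apply: fin; first by rewrite normrN ger0_norm.
move=> x; rewrite /f -mulrA ler_wpM2l ?expR_ge0// mulrDl divfK ?pnatr_eq0//.
by have := expR_ge0 (x * ln (1 + q)); lra.
Qed.

(** * Analytic continuation *)

Lemma connected_sub_open_closed (T : topologicalType) (A S : set T) :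
  connected A -> A `&` S !=set0 -> open S ->
  (forall x, A x -> closure S x -> S x) -> A `<=` S.
Proof.
move=> cA AS oS clS; suff <- : A `&` S = A by exact: subIsetr.
apply: cA => //; first by exists S.
exists (closure S); first exact: closed_closure.
apply/seteqP; split=> x [Ax Sx]; split=> //; first exact: subset_closure.
exact: clS.
Qed.

Definition cpow_integral (R : realType) (mu : borel_measure R) (l : R[i]) : R[i] :=
  cintegral mu (cpow (1 + l)).

(** Demanding a whole disc makes the set of such z open and supplies points of agreement
    accumulating at each of its limit points. *)
Definition represented_near (R : realType) (mu : borel_measure R) (B : R[i] -> R[i])
    (z : R[i]) : Prop :=
  exists2 e : R, 0 < e & forall w, cmod (w - z) < e ->
    cintegrable mu (cpow (1 + w)) /\ B w = cpow_integral mu w.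

Lemma represented_near_ball (R : realType) (mu : borel_measure R) (B : R[i] -> R[i])
    (z : R[i]) : represented_near mu B z ->
  exists2 e : R, 0 < e & forall w, cmod (w - z) < e -> represented_near mu B w.
Proof.
move=> [e e0 he]; exists e => // w wz; exists (e - cmod (w - z)); first by rewrite subr_gt0.
move=> y yw; apply: he; rewrite -(subrKA w) (le_lt_trans (cmodD _ _))//.
by rewrite -ltrBrDr.
Qed.

Lemma open_represented_near (R : realType) (mu : borel_measure R) (B : R[i] -> R[i]) :
  open [set z | represented_near mu B z].
Proof.
rewrite openE => z /= /represented_near_ball[e e0 he].
by apply/nbhs_cmodP; exists e.
Qed.

Lemma exp_integrable_near (R : realType) (mu : borel_measure R) (r1 r r2 : R) :
  0 < r1 -> r1 < r -> r < r2 ->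
  exp_integrable mu (ln r1) -> exp_integrable mu (ln r2) ->
  exists d : R, [/\ 0 < d, exp_integrable mu (ln r - d) & exp_integrable mu (ln r + d)].
Proof.
move=> r10 r1r rr2 i1 i2; have r0 : 0 < r by exact: lt_trans r1r.
have r20 : 0 < r2 by exact: lt_trans rr2.
have l1 : ln r1 < ln r by rewrite ltr_ln.
have l2 : ln r < ln r2 by rewrite ltr_ln.
pose d := Num.min (ln r - ln r1) (ln r2 - ln r).
have d0 : 0 < d by rewrite lt_min !subr_gt0 l1.
have d1 : d <= ln r - ln r1 by rewrite ge_min lexx.
have d2 : d <= ln r2 - ln r by rewrite ge_min lexx orbT.
by exists d; split=> //; apply: exp_integrable_between i1 i2 _ _; lra.
Qed.

Lemma add1_subr1 (R : realType) (r : R) : 1 + (r - 1)%:C = r%:C :> R[i].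
Proof. by rewrite -(rmorph1 (real_complex R)) -rmorphD /=; congr (_%:C); ring. Qed.

Lemma represented_near_exp_integrable (R : realType) (mu : borel_measure R)
    (B : R[i] -> R[i]) (r : R) : 0 < r -> represented_near mu B (r - 1)%:C ->
  exists d : R, [/\ 0 < d, exp_integrable mu (ln r - d) & exp_integrable mu (ln r + d)].
Proof.
move=> r0 [e e0 he]; pose t := Num.min (e / 2) (r / 2).
have t0 : 0 < t by rewrite lt_min !divr_gt0.
have te : t < e by rewrite gt_min ltr_pdivrMr// ltr_pMr// ltr1n.
have tr : t < r by rewrite gt_min orbC ltr_pdivrMr// ltr_pMr// ltr1n.
have key s : `|s| = t -> exp_integrable mu (ln (r + s)).
  move=> st; have s0 : 0 < r + s by move: (ler_norm (- s)); rewrite normrN st; lra.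
  apply: cpow_integrable_exp => //.
  rewrite -add1_subr1.
  apply: (he _ _).1; rewrite -rmorphB cmod_real.
  have -> : r + s - 1 - (r - 1) = s by ring.
  by rewrite st.
apply: (@exp_integrable_near _ _ (r - t) _ (r + t)).
- by rewrite subr_gt0.
- by rewrite ltrBlDr ltrDl.
- by rewrite ltrDl.
- by apply: key; rewrite normrN gtr0_norm.
- by apply: key; rewrite gtr0_norm.
Qed.

(** Exponential integrability around ln |1 + z| makes the integral a power series about z. It then
    has the coefficients of B by uniqueness, so both agree on a disc. *)
Lemma represented_near_extend (R : realType) (mu : borel_measure R) (B : R[i] -> R[i])
    (z : R[i]) (a : nat -> R[i]) (rho d : R) :
  0 < rho -> (forall h, cmod h < rho -> has_psum a h (B (z + h))) ->
  slit_plane (1 + z) -> 0 < d ->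
  exp_integrable mu (ln (cmod (1 + z)) - d) ->
  exp_integrable mu (ln (cmod (1 + z)) + d) ->
  (forall e : R, 0 < e -> exists w, [/\ 0 < cmod (w - z), cmod (w - z) < e &
     B w = cpow_integral mu w]) ->
  represented_near mu B z.
Proof.
move=> rho0 aB hz d0 i1 i2 hw.
have [_ [r r0 hr]] := cpow_expansion hz d0 i1 i2.
set b := (fun n => _) in hr.
pose m := Num.min rho r; have m0 : 0 < m by rewrite lt_min rho0.
have aB' h : cmod h < m -> has_psum a h (B (z + h)).
  by rewrite lt_min => /andP[h1 _]; exact: aB.
have bH h : cmod h < m -> has_psum b h (cpow_integral mu (z + h)).
  by rewrite lt_min => /andP[_ h1]; rewrite /cpow_integral addrA; exact: (hr h h1).2.
have ab : a = b.
  apply: (psum_unique m0 aB' bH) => e e0; have [w [w1 w2 w3]] := hw e e0.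
  by exists (w - z); have -> : z + (w - z) = w by rewrite addrC subrK.
exists m => // w wz.
have zw : w = z + (w - z) by rewrite addrC subrK.
rewrite zw; split.
  by move: wz; rewrite lt_min => /andP[_ h1]; rewrite addrA; exact: (hr _ h1).1.
have h1 := aB' _ wz; have h2 := bH _ wz; rewrite ab in h1.
exact: has_psum_unique h1 h2.
Qed.

(** The nearby point may be z itself; a small real shift inside its disc then gives a point distinct
    from z. *)
Lemma closure_represented_near (R : realType) (mu : borel_measure R) (B : R[i] -> R[i])
    (z : R[i]) :
  (forall e : R, 0 < e -> exists2 w, cmod (w - z) < e & represented_near mu B w) ->
  forall e : R, 0 < e -> exists w, [/\ 0 < cmod (w - z), cmod (w - z) < e &
     B w = cpow_integral mu w].
Proof.
move=> hz e e0; have [w wz [r r0 hr]] := hz e e0.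
have [wz0|wz0] := eqVneq w z; last first.
  exists w; split=> //; first by rewrite cmod_gt0 subr_eq0.
  by apply: (hr w _).2; rewrite subrr cmod0.
pose t := Num.min (e / 2) (r / 2).
have t0 : 0 < t by rewrite lt_min !divr_gt0.
have te : t < e by rewrite gt_min ltr_pdivrMr// ltr_pMr// ltr1n.
have tr : t < r by rewrite gt_min orbC ltr_pdivrMr// ltr_pMr// ltr1n.
have ct : cmod (z + t%:C - z) = t by rewrite addrAC subrr add0r cmod_real gtr0_norm.
exists (z + t%:C); rewrite ct; split=> //.
by apply: (hr _ _).2; rewrite wz0 ct.
Qed.

Lemma analytic_on_psum (R : realType) (U : set R[i]) (B : R[i] -> R[i]) (z : R[i]) :
  analytic_on U B -> U z ->
  exists a : nat -> R[i], exists2 rho : R, 0 < rho &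
    forall h, cmod h < rho -> has_psum a h (B (z + h)).
Proof.
move=> aB Uz; have [a /nbhs_cmodP[rho rho0 ha]] := aB z Uz.
by exists a, rho => // h hr; apply: ha; rewrite subr0.
Qed.

(* Expand B at a point s near r where it is already represented: the radius of convergence
   reaches beyond r, and landau_step carries integrability from s across r. *)
Lemma represented_near_real_closed (R : realType) (mu : borel_measure R)
    (B : R[i] -> R[i]) (r : R) (a : nat -> R[i]) (rho : R) :
  0 < r -> 0 < rho -> (forall h, cmod h < rho -> has_psum a h (B ((r - 1)%:C + h))) ->
  (forall e : R, 0 < e -> exists2 s, `|s - r| < e & represented_near mu B (s - 1)%:C) ->
  represented_near mu B (r - 1)%:C.
Proof.
move=> r0 rho0 aB hr.
(* With |s - r| < p, the points s - 2p and s + 2p enclose r, while 2p stays below both s and the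
   radius rho - |s - r| of the expansion about s. *)
pose p := Num.min rho r / 4.
have m0 : 0 < Num.min rho r by rewrite lt_min rho0.
have p0 : 0 < p by rewrite divr_gt0.
have p1 : 4 * p <= rho by rewrite mulrC divfK ?pnatr_eq0// ge_min lexx.
have p2 : 4 * p <= r by rewrite mulrC divfK ?pnatr_eq0// ge_min lexx orbT.
have [s sr Ps] := hr p p0; have /ltr_normlP[sr1 sr2] := sr.
have s0 : 0 < s by lra.
have [d [d0 i1 i2]] := represented_near_exp_integrable s0 Ps.
pose D := (s - r)%:C : R[i].
have cD : cmod D < p by rewrite cmod_real.
have [|b [_ hb]] := psum_recenter aB (d := D); first by lra.
have cs : cmod s%:C = s by rewrite cmod_real gtr0_norm.
have [||_ [e e0 he]] := @cpow_expansion _ mu s%:C d (slit_plane_pos s0) d0.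
- by rewrite cs.
- by rewrite cs.
set c := (fun n => _) in he.
have [e' e'0 he'] := Ps.
pose m := Num.min e (rho - cmod D).
have mm0 : 0 < m by rewrite lt_min e0 subr_gt0; lra.
have zD h : (r - 1)%:C + (D + h) = (s - 1)%:C + h.
  by rewrite addrA -rmorphD /=; congr (_%:C + _); ring.
have sH h : 1 + ((s - 1)%:C + h) = s%:C + h.
  by rewrite addrA add1_subr1.
(* B and the integral agree only near s, but equality of coefficients carries the larger radius of b
   over to the moment series c. *)
have bc : b = c.
  apply: (@psum_unique _ b c (fun h => B ((s - 1)%:C + h))
     (fun h => cpow_integral mu ((s - 1)%:C + h)) m) => //.
  - by move=> h; rewrite lt_min => /andP[_ h1]; rewrite -zD; exact: hb.
  - move=> h; rewrite lt_min => /andP[h1 _]; rewrite /cpow_integral sH.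
    exact: (he h h1).2.
  - move=> y y0; pose t := Num.min (y / 2) (e' / 2).
    have t0 : 0 < t by rewrite lt_min !divr_gt0.
    have ty : t < y by rewrite gt_min ltr_pdivrMr// ltr_pMr// ltr1n.
    have te : t < e' by rewrite gt_min orbC ltr_pdivrMr// ltr_pMr// ltr1n.
    have ct : cmod t%:C = t by rewrite cmod_real gtr0_norm.
    exists t%:C; rewrite ct; split=> //; apply: (he' _ _).2.
    by rewrite addrAC subrr add0r ct.
have [] := @landau_step _ mu s d (rho - cmod D) (2 * p)
   (fun h => B ((s - 1)%:C + h)) s0 d0 i1 i2.
- by move=> h h1; rewrite -/c -bc -zD; exact: hb.
- lra.
- lra.
- lra.
move=> j1 j2.
have [|||d' [d'0 k1 k2]] := @exp_integrable_near _ mu (s - 2 * p) r (s + 2 * p) _ _ _ j2 j1.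
- lra.
- lra.
- lra.
have r1 := add1_subr1 r.
have cr : cmod r%:C = r by rewrite cmod_real gtr0_norm.
apply: (represented_near_extend rho0 aB _ d'0); rewrite ?r1 ?cr//.
  exact: slit_plane_pos.
apply: closure_represented_near => y y0; have [x xr Px] := hr y y0.
exists (x - 1)%:C => //; rewrite -rmorphB cmod_real.
by have -> : x - 1 - (r - 1) = x - r by ring.
Qed.

Lemma analytic_represented_everywhere (R : realType) (mu : borel_measure R)
    (U : set R[i]) (B : R[i] -> R[i]) :
  log_domain U -> analytic_on U B -> represented_near mu B 0 ->
  forall l, U l -> represented_near mu B l.
Proof.
move=> [[oU U0] cU slU absU] aB P0.
pose A := [set r : R | U (r - 1)%:C].
(* The last two conditions of [log_domain] identify the real trace with the image of U under |1 +
   l|, so A inherits connectedness from U. *)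
have AE : A = (fun l : R[i] => cmod (1 + l)) @` U.
  apply/seteqP; split=> [r Ur|_ [l Ul <-]].
    exists (r - 1)%:C => //.
    have := slU _ Ur; rewrite add1_subr1 cmod_real => h; rewrite gtr0_norm// ltNge.
    by apply/negP => r0; apply: h.
  by rewrite /A /= rmorphB /= -normr_cmod; exact: absU.
have Apos r : A r -> 0 < r.
  rewrite AE => -[l Ul <-]; rewrite cmod_gt0.
  by apply: slit_plane_neq0; exact: slU.
have cA : connected A.
  rewrite AE; apply: connected_continuous_connected => //.
  suff cf : continuous (fun l : R[i] => cmod (1 + l)) by exact: continuous_subspaceT.
  move=> l P /nbhs_ballP[e /= e0 he]; rewrite nbhs_filterE /=.
  apply/nbhs_cmodP; exists e => // w wl; apply: he; rewrite /ball /=.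
  rewrite (le_lt_trans (cmod_dist_le _ _))//.
  by rewrite opprD addrACA subrr add0r cmod_distC.
(* A is the trace of 1 + U on the half-line, where positivity of the integrands makes
   landau_step available; the complex points of U only need the identity theorem. *)
have AS : A `<=` [set r : R | represented_near mu B (r - 1)%:C].
  apply: connected_sub_open_closed => //.
  - by exists 1; split; rewrite /A /= subrr.
  - rewrite openE => r /= /represented_near_ball[e e0 he].
    apply/nbhs_ballP; exists e => //= s; rewrite /ball /= => rs; apply: he.
    rewrite -rmorphB cmod_real distrC.
    by have -> : r - 1 - (s - 1) = r - s by ring.
  - move=> r Ar clr; have [a [rho rho0 ha]] := analytic_on_psum aB Ar.
    apply: (represented_near_real_closed (Apos _ Ar) rho0 ha) => e e0.
    have [s [Ps rs]] := clr _ (nbhsx_ballx r e e0).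
    by exists s => //; rewrite distrC.
move=> l Ul; suff : U `<=` [set z | represented_near mu B z] by exact.
apply: connected_sub_open_closed => //.
- by exists 0.
- exact: open_represented_near.
move=> z Uz clz; have [a [rho rho0 ha]] := analytic_on_psum aB Uz.
(* Integrability at a complex z is read off at the real point of the same modulus, where the first
   stage has provided it. *)
have Az : A (cmod (1 + z)) by rewrite AE; exists z.
have [d [d0 i1 i2]] := represented_near_exp_integrable (Apos _ Az) (AS _ Az).
apply: (represented_near_extend rho0 ha (slU _ Uz) d0 i1 i2).
apply: closure_represented_near => e e0.
have [|w [Pw wz]] := clz [set w | cmod (w - z) < e].
  by apply/nbhs_cmodP; exists e.
by exists w.
Qed.

(** * Moments *)

(** The case z = 1 of [cpow_expansion]: the weight is 1, so the coefficients are plain Newton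
    moments divided by n!. *)
Lemma moment_expansion (R : realType) (mu : borel_measure R) (d : R) :
  0 < d -> exp_integrable mu (- d) -> exp_integrable mu d ->
  (forall n, mu.-integrable setT (EFin \o @newton R n)) /\
  exists2 rho : R, 0 < rho & forall l, cmod l < rho ->
    cintegrable mu (cpow (1 + l)) /\
    has_psum (fun n => (Rintegral mu setT (@newton R n))%:C / n`!%:R) l
      (cpow_integral mu l).
Proof.
move=> d0 i1 i2.
have c1 (x : R) : cpow 1 x = 1.
  by rewrite -[1 in LHS](rmorph1 (real_complex R)) cpow_pos// ln1 mulr0 expR0.
have s1 : slit_plane (1 : R[i]) by exact: (slit_plane_pos ltr01).
have [||iw [rho rho0 hr]] := @cpow_expansion _ mu 1 d s1 d0.
- by rewrite cmod1 ln1 sub0r.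
- by rewrite cmod1 ln1 add0r.
have f0 n : n`!%:R != 0 :> R by rewrite pnatr_eq0 -lt0n fact_gt0.
have inw n : mu.-integrable setT (EFin \o @newton R n).
  have i3 : mu.-integrable setT (EFin \o (fun x : R => nbin x n)).
    have -> : (fun x : R => nbin x n) = (fun x => Re (cpow 1 x * (nbin x n)%:C)).
      by apply/funext => x; rewrite c1 mul1r.
    by case: (iw n).
  have -> : @newton R n = (fun x => nbin x n * n`!%:R).
    by apply/funext => x; rewrite /nbin divfK.
  by have := integrableZr measurableT n`!%:R i3; apply.
split=> //; exists rho => // l lr; have [h1 h2] := hr l lr; split=> //.
move: h2; set u := (fun n => _); set v := (fun n => _ / _).
have -> // : u = v.
apply/funext => n; rewrite /u /v invr1 expr1n mulr1.
have -> : (fun x : R => cpow 1 x * (nbin x n)%:C) = (fun x : R => (newton n x * n`!%:R^-1)%:C).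
  by apply/funext => x; rewrite c1 mul1r.
rewrite cintegral_real RintegralZr// rmorphM fmorphV rmorph_nat.
by [].
Qed.

(** Pivot for all three equivalences. Backwards, convergence of the integrals near 0 yields
    exponential integrability; the same function then has a second expansion whose coefficients are
    the moments, and uniqueness identifies tau with them. *)
Lemma analytic_moment_functional_expansion (R : realType) (tau : nat -> R[i]) :
  analytic_moment_functional tau <->
  exists mu : borel_measure R, exists2 rho : R, 0 < rho & forall l, cmod l < rho ->
    cintegrable mu (cpow (1 + l)) /\
    has_psum (fun n => tau n / n`!%:R) l (cpow_integral mu l).
Proof.
split.
  move=> [mu /analytic_laplace_exp_integrable[d [d0 i1 i2]] tauE].
  have [_ [rho rho0 hr]] := moment_expansion d0 i1 i2.
  exists mu, rho => // l lr; have := hr l lr.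
  set u := (fun n => _ / _); set v := (fun n => _ / _).
  have -> // : u = v.
  by apply/funext => n; rewrite /u /v (tauE n).2.
move=> [mu [rho rho0 hr]].
have [d [d0 i1 i2]] : exists d : R, [/\ 0 < d, exp_integrable mu (- d) & exp_integrable mu d].
  apply: (@cpow_near1_exp_integrable _ _ [set l : R[i] | cmod l < rho]).
    by apply/nbhs_cmodP; exists rho => // w; rewrite subr0.
  by move=> l lr; exact: (hr l lr).1.
have [inw [rho' rho'0 hr']] := moment_expansion d0 i1 i2.
exists mu; first exact: exp_integrable_analytic_laplace d0 i1 i2.
move=> n; split; first exact: inw.
pose m := Num.min rho rho'; have m0 : 0 < m by rewrite lt_min rho0.
have E : (fun n => tau n / n`!%:R) =
    (fun n => (Rintegral mu setT (@newton R n))%:C / n`!%:R).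
  apply: (psum_unique m0 (f := cpow_integral mu) (g := cpow_integral mu)).
  - by move=> h; rewrite lt_min => /andP[h1 _]; exact: (hr h h1).2.
  - by move=> h; rewrite lt_min => /andP[_ h1]; exact: (hr' h h1).2.
  - move=> e e0; exists (e / 2)%:C; split=> //; rewrite cmod_real gtr0_norm ?divr_gt0//.
    by rewrite ltr_pdivrMr// ltr_pMr// ltr1n.
have f0 : n`!%:R != 0 :> R[i] by rewrite pnatr_eq0 -lt0n fact_gt0.
by have := congr1 (fun u => u n * n`!%:R) E; rewrite /= !divfK.
Qed.

(** * From generating functions to moment functionals and back *)

Lemma gen_seriesE (R : realType) (tau : nat -> R[i]) (l : R[i]) :
  gen_series tau l = series (fun n => tau n / n`!%:R * l ^+ n).
Proof.
rewrite /gen_series; congr series; apply/funext => n.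
by ring.
Qed.

Lemma gen_series_limn (R : realType) (tau : nat -> R[i]) (l s : R[i]) :
  has_psum (fun n => tau n / n`!%:R) l s -> limn (gen_series tau l) = s.
Proof. by rewrite gen_seriesE => h; apply: cvg_lim => //; exact: norm_hausdorff. Qed.

Lemma cmod_lt1_add1_neq0 (R : realType) (l : R[i]) : cmod l < 1 -> 1 + l != 0.
Proof.
by apply: contraTneq => /eqP; rewrite addrC addr_eq0 => /eqP ->; rewrite cmodN cmod1 ltxx.
Qed.

Lemma derivatives_at0_coef (R : realType) (a : nat -> R[i]) (B : R[i] -> R[i]) (rho : R) :
  0 < rho -> (forall h, cmod h < rho -> has_psum a h (B (0 + h))) ->
  (fun n => derivatives_at0 B n / n`!%:R) = a.
Proof.
move=> rho0 ha; apply/funext => n.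
have ha' h : cmod h < rho -> has_psum a h (B h) by move=> /ha; rewrite add0r.
rewrite (derivatives_at0_psum n rho0 ha') -[_ *+ _]mulr_natr mulfK//.
Qed.

(** Analyticity and the representation meet only near 0, so their domains are kept independent; this
    serves both V = U and a smaller V. *)
Lemma bogoliubov_moment (R : realType) (U V : set R[i]) (B : R[i] -> R[i]) :
  U 0 -> analytic_on U B -> bogoliubov_in V B ->
  analytic_moment_functional (derivatives_at0 B).
Proof.
move=> U0 aB [/nbhs_cmodP[e e0 he] _ [mu hmu]].
have [a [rho rho0 ha]] := analytic_on_psum aB U0.
apply/analytic_moment_functional_expansion; exists mu, (Num.min e rho).
  by rewrite lt_min e0.
move=> l; rewrite lt_min => /andP[le lr].
have [|i1 BE] := hmu l _; first by apply: he; rewrite subr0.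
rewrite (derivatives_at0_coef rho0 ha) /cpow_integral -BE -[l in B l]add0r.
by split=> //; exact: ha.
Qed.

Lemma moment_represented_near (R : realType) (U : set R[i]) (B : R[i] -> R[i]) :
  U 0 -> analytic_on U B -> analytic_moment_functional (derivatives_at0 B) ->
  exists mu, represented_near mu B 0.
Proof.
move=> U0 aB /analytic_moment_functional_expansion[mu [rho rho0 hr]].
have [a [rho' rho'0 ha]] := analytic_on_psum aB U0.
exists mu; exists (Num.min rho rho'); first by rewrite lt_min rho0.
move=> l; rewrite subr0 lt_min => /andP[lr lr'].
have [i1 p1] := hr l lr; split=> //.
rewrite (derivatives_at0_coef rho'0 ha) in p1.
by have := ha l lr'; rewrite add0r => p2; exact: has_psum_unique p2 p1.
Qed.

Theorem theorem6p10 (R : realType) :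
  (forall tau : nat -> R[i],
     analytic_moment_functional tau <->
     exists2 U : set R[i],
       (forall l, U l -> cvgn (gen_series tau l)) &
       bogoliubov_in U (fun l => limn (gen_series tau l))) /\
  (forall (U : set R[i]) (B : R[i] -> R[i]),
     log_domain U -> analytic_on U B ->
     bogoliubov_in U B <-> analytic_moment_functional (derivatives_at0 B)) /\
  (forall (U : set R[i]) (B : R[i] -> R[i]),
     open_nbhs 0 U -> analytic_on U B ->
     (exists2 V : set R[i], V `<=` U & bogoliubov_in V B) <->
     analytic_moment_functional (derivatives_at0 B)).
Proof.
split; last split.
- move=> tau; split.
    move=> /analytic_moment_functional_expansion[mu [rho rho0 hr]].
    (* The bound 1 keeps 1 + l away from 0. *)
    exists [set l : R[i] | cmod l < Num.min rho 1].
      move=> l /=; rewrite lt_min => /andP[lr _].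
      by rewrite gen_seriesE; apply: cvgP (hr l lr).2.
    split.
    + apply/nbhs_cmodP; exists (Num.min rho 1); first by rewrite lt_min rho0 ltr01.
      by move=> w; rewrite subr0.
    + by move=> l /=; rewrite lt_min => /andP[_ l1]; exact: cmod_lt1_add1_neq0.
    + exists mu => l /=; rewrite lt_min => /andP[lr _].
      have [i1 p1] := hr l lr; split=> //.
      exact: gen_series_limn.
  move=> [U cU [/nbhs_cmodP[e e0 he] _ [mu hmu]]].
  apply/analytic_moment_functional_expansion; exists mu, e => // l le.
  have Ul : U l by apply: he; rewrite subr0.
  have [i1 BE] := hmu l Ul; split=> //; rewrite /cpow_integral -BE /has_psum.
  (* The convergence [cU] turns the value [limn] into the actual sum of the series. *)
  by rewrite gen_seriesE; have := cU l Ul; rewrite gen_seriesE.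
- move=> U B dU aB; have [[oU U0] _ slU _] := dU; split.
    exact: bogoliubov_moment aB.
  move=> /(moment_represented_near U0 aB)[mu P0]; split.
  + exact: open_nbhs_nbhs.
  + by move=> l Ul; apply: slit_plane_neq0; exact: slU.
  + exists mu => l Ul.
    have [e e0 he] := analytic_represented_everywhere dU aB P0 Ul.
    by apply: he; rewrite subrr cmod0.
- move=> U B [oU U0] aB; split.
    by move=> [V _]; exact: bogoliubov_moment aB.
  move=> /(moment_represented_near U0 aB)[mu [e e0 he]].
  exists (U `&` [set l : R[i] | cmod l < Num.min e 1]); first exact: subIsetl.
  split.
  + apply: filterI; first exact: open_nbhs_nbhs.
    apply/nbhs_cmodP; exists (Num.min e 1); first by rewrite lt_min e0 ltr01.
    by move=> w; rewrite subr0.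
  + by move=> l [_ /=]; rewrite lt_min => /andP[_ l1]; exact: cmod_lt1_add1_neq0.
  + by exists mu => l [_ /=]; rewrite lt_min => /andP[l1 _]; apply: he; rewrite subr0.
Qed.
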